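(* The Gromov-Hausdorff distance $\varrho_{GH}$ on $F(\mathbb{U})\setminus\{\emptyset\}$ is Borel-u.c. bireducible with the orbit pseudometric $\varrho_{Iso(\mathbb{U}),\varrho_H}$ on $F(\mathbb{U})\setminus\{\emptyset\}$, defined by $\varrho_{Iso(\mathbb{U}),\varrho_H}(A,B)=\inf_{I\in Iso(\mathbb{U})}\varrho_H(I(A),B)$; that is, each of the two pseudometrics is Borel-u.c. reducible to the other.
   Context: Pseudometrics may take the value $\infty$. For pseudometrics $\varrho_X,\varrho_Y$ on Polish spaces $X,Y$, $\varrho_X$ is Borel-u.c. reducible to $\varrho_Y$ if there is a Borel map $f:X\to Y$ such that for every $\varepsilon>0$ there are $\delta_X,\delta_Y>0$ with $\varrho_X(x,x')<\delta_X\Rightarrow\varrho_Y(f(x),f(x'))<\varepsilon$ and $\varrho_Y(f(x),f(x'))<\delta_Y\Rightarrow\varrho_X(x,x')<\varepsilon$ for all $x,x'$. The Urysohn space $\mathbb{U}$ is the unique (up to isometry) Polish metric space such that every isometric embedding into $\mathbb{U}$ of a subset $B$ of a finite metric space $A$ extends to an isometric embedding of $A$. $F(\mathbb{U})\setminus\{\emptyset\}$ is the set of nonempty closed subsets of $\mathbb{U}$ with the Wijsman topology (coarsest topology making $F\mapsto\mathrm{dist}(x,F)$ continuous for each $x\in\mathbb{U}$), a Polish space. $\varrho_H$ is the Hausdorff distance of subsets of $\mathbb{U}$. $\varrho_{GH}(M,N)$ is the infimum of $\varrho_H(i_M(M),i_N(N))$ over all metric spaces $Z$ and isometric embeddings $i_M:M\to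 Z$, $i_N:N\to Z$. $Iso(\mathbb{U})$ is the group of surjective isometries of $\mathbb{U}$ with the topology of pointwise convergence. *)

(* Defs.v *)
From HB Require Import structures.
From mathcomp Require Import all_boot all_order all_algebra.
From mathcomp Require Import all_classical all_reals all_analysis.
Import Order.TTheory GRing.Theory Num.Theory.
Import numFieldNormedType.Exports.

Set Implicit Arguments.
Unset Strict Implicit.
Unset Printing Implicit Defensive.

Local Open Scope classical_set_scope.
Local Open Scope ring_scope.

Section subset_metric.
Context {R : realType} {X : metricType R} (A : set X).

Let sdist (x y : A) : R := mdist (set_val x) (set_val y).

Let sdist_ge0 x y : 0 <= sdist x y.
Proof. exact: mdist_ge0. Qed.

Let sdist_positivity x y : sdist x y = 0 -> x = y.
Proof. by move=> /mdist_positivity/val_inj. Qed.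

Let ballE_sdist (x : A) d : ball x d = [set y | sdist x y < d].
Proof. by rewrite -initial_ballE ballEmdist. Qed.

HB.instance Definition _ := @PseudoMetric_isMetric.Build R (A : Type)
  sdist sdist_ge0 sdist_positivity ballE_sdist.

End subset_metric.

Lemma mdist_set_val (R : realType) (X : metricType R) (A : set X) (x y : A) :
  mdist x y = mdist (set_val x) (set_val y).
Proof. by []. Qed.

Lemma edist_mdist (R : realType) (X : metricType R) (x y : X) :
  edist (x, y) = (mdist x y)%:E.
Proof.
apply/eqP; rewrite eq_le; apply/andP; split; last first.
  apply: le_ereal_inf_tmp => _ [r [_ xyr] <-]; rewrite lee_fin ltW//.
  by move: xyr; rewrite ballEmdist.
apply/lee_addgt0Pr => e e0; rewrite -EFinD; apply: ereal_inf_lbound.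
exists (mdist x y + e) => //; split => /=; last by rewrite ballEmdist/= ltrDl.
by rewrite (lt_le_trans e0)// lerDr mdist_ge0.
Qed.

Definition isometric_embedding {R : realType} {X Y : metricType R}
  (f : X -> Y) := forall x y, mdist (f x) (f y) = mdist x y.

Definition Iso {R : realType} (X : metricType R) : set (X -> X) :=
  [set f | isometric_embedding f /\ range f = setT].
Arguments Iso {R} X.

Definition separable (X : topologicalType) :=
  exists2 D : set X, countable D & dense D.

(* The library's Uniform_isComplete requires a chosen point. *)
Definition complete_space (X : uniformType) :=
  forall F : set_system X, ProperFilter F -> cauchy F -> exists x : X, F --> x.

(* B may be empty here, so that a Urysohn space is nonempty. *)
Definition finite_extension_property {R : realType} (U : metricType R) :=
  forall (A : metricType R) (B : set A) (f : B -> U),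
    finite_set [set: A] -> isometric_embedding f ->
    exists2 g : A -> U, isometric_embedding g & forall b : B, g (set_val b) = f b.

Definition urysohn_space {R : realType} (U : metricType R) :=
  [/\ separable U, complete_space U & finite_extension_property U].

(* By edist_mdist, edist_inf A x is dist(x, A); the formula is meant for nonempty A and B. *)
Definition hausdorff_dist {R : realType} {X : metricType R} (A B : set X) :
    \bar R :=
  maxe (ereal_sup [set edist_inf B a | a in A])
       (ereal_sup [set edist_inf A b | b in B]).

Definition gh_dist {R : realType} (X Y : metricType R) : \bar R :=
  ereal_inf [set r | exists (Z : metricType R) (i : X -> Z) (j : Y -> Z),
    [/\ isometric_embedding i, isometric_embedding j &
        r = hausdorff_dist (range i) (range j)]].

Record nonempty_closed {R : realType} (X : metricType R) := NonemptyClosed {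
  closed_val :> set X;
  closed_valP : closed closed_val;
  closed_val_neq0 : closed_val !=set0
}.

(* The Wijsman topology; dist(x, F) is finite since F is nonempty. *)
Section wijsman.
Context {R : realType} (X : metricType R).

Definition dist_to (x : X) (F : nonempty_closed X) : R := fine (edist_inf F x).

HB.instance Definition _ := gen_eqMixin (nonempty_closed X).
HB.instance Definition _ := gen_choiceMixin (nonempty_closed X).
HB.instance Definition _ := Topological.copy (nonempty_closed X)
  (sup_topology (fun x : X => Topological.on (initial_topology (dist_to x)))).

End wijsman.

Definition GH {R : realType} {X : metricType R} (A B : nonempty_closed X) :
  \bar R := gh_dist (set_type A) (set_type B).

Definition orbit_hausdorff {R : realType} {X : metricType R}
    (A B : nonempty_closed X) : \bar R :=
  ereal_inf [set hausdorff_dist (f @` A) B | f in Iso X].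

Definition borel_map {X Y : topologicalType} (f : X -> Y) :=
  forall B : set Y, <<s @open Y >> B -> <<s @open X >> (f @^-1` B).

Definition borel_uc_reducible {R : realType} {X Y : topologicalType}
    (rX : X -> X -> \bar R) (rY : Y -> Y -> \bar R) :=
  exists2 f : X -> Y, borel_map f &
    forall e : R, 0 < e -> exists dX dY : R,
      [/\ 0 < dX, 0 < dY,
          forall x x', (rX x x' < dX%:E)%E -> (rY (f x) (f x') < e%:E)%E &
          forall x x', (rY (f x) (f x') < dY%:E)%E -> (rX x x' < e%:E)%E].

Definition borel_uc_bireducible {R : realType} {X Y : topologicalType}
    (rX : X -> X -> \bar R) (rY : Y -> Y -> \bar R) :=
  borel_uc_reducible rX rY /\ borel_uc_reducible rY rX.

(* Main.v *)
(* Both pseudometrics are compared through correspondences: GH is small iff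
   there is a total relation of small distortion between the two sets.

   From GH to the orbit pseudometric. The Urysohn space U contains a copy of a
   countable rational metric space of codes, all points of a dense set having
   finite support over it as in Katetov's construction; hence every isometry of
   the code space, in particular every permutation of its indices, extends to U.
   A closed set A with a Borel dense sequence (a_i), each point repeated
   infinitely often, is sent to the set of codes recording the distances
   d(a_i, a_j). A correspondence of small distortion yields a permutation
   matching the recorded distances of two sets, and conversely the matrix of
   recorded distances is recovered, up to a permutation, from any set Hausdorff
   close to an isometric image of the set of codes.

   From the orbit pseudometric to GH. A is sent to a subset of U isometric to a
   marked copy of A together with copies of (U, 2^k d) for all k >= 1, truncated
   at 4^k and glued at known distances. A correspondence of small distortion
   between two such sets preserves the copies, so it induces maps of U whose
   distortion tends to 0 with k; they converge to an isometry of U moving A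
   close to B. *)

From HB Require Import structures.
Require Import Defs.
From mathcomp Require Import all_boot all_order all_algebra.
From mathcomp Require Import all_classical all_reals all_analysis.
From mathcomp Require Import zify lra.
Import Order.TTheory GRing.Theory Num.Theory.
Import numFieldNormedType.Exports.

Set Implicit Arguments.
Unset Strict Implicit.
Unset Printing Implicit Defensive.

Local Open Scope classical_set_scope.
Local Open Scope ring_scope.

(** * Metric spaces with the finite extension property *)

Record is_metric {R : realType} (T : Type) (d : T -> T -> R) : Prop := IsMetric {
  is_metricxx : forall x, d x x = 0;
  is_metric_eq : forall x y, d x y = 0 -> x = y;
  is_metric_sym : forall x y, d x y = d y x;
  is_metric_tri : forall y x z, d x z <= d x y + d y z
}.

(** The metric, through its proof, is an index of the type, so that ad hoc metrics can be passed
    where a [metricType] is quantified over. *)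
Definition metric_of {R : realType} (T : choiceType) (d : T -> T -> R)
  (dP : is_metric d) : Type := T.

HB.instance Definition _ (R : realType) (T : choiceType) (d : T -> T -> R)
  (dP : is_metric d) := Choice.copy (metric_of dP) T.
HB.instance Definition _ (R : realType) (T : choiceType) (d : T -> T -> R)
  (dP : is_metric d) := @isMetric.Build R (metric_of dP) d
    (is_metricxx dP) (is_metric_eq dP) (is_metric_sym dP) (is_metric_tri dP).

Section finite_extension.
Context {R : realType} {U : metricType R}.
Hypothesis hU : finite_extension_property U.

(** The hypotheses on [g] are Katetov's conditions: they turn [s] with one extra point into a finite
    metric space, and the embedding of [s] extends to it. *)
Lemma katetov_realized (s : seq U) (g : U -> R) :
  (forall x y, x \in s -> y \in s ->
    g x <= mdist x y + g y /\ mdist x y <= g x + g y) ->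
  exists y, forall x, x \in s -> mdist y x = g x.
Proof.
move=> gK; have g_ge0 x : x \in s -> 0 <= g x.
  by move=> xs; have [_] := gK x x xs xs; rewrite mdistxx; lra.
(* A zero of [g] would put the extra point at distance 0 from a point of [s]; that point is then
   itself the answer. *)
have [[x0 x0s gx0]|g_neq0] := pselect (exists2 x, x \in s & g x = 0).
  exists x0 => x xs; have := gK x0 x x0s xs; have := gK x x0 xs x0s.
  by rewrite (metric_sym x x0); lra.
have g_gt0 x : x \in s -> 0 < g x.
  move=> xs; rewrite lt_neqAle g_ge0// andbT; apply/eqP => /esym gx.
  by apply: g_neq0; exists x.
pose T : choiceType := option (seq_sub s).
pose d (a b : T) : R := match a, b with
  | None, None => 0 | None, Some x => g (val x) | Some x, None => g (val x)
  | Some x, Some y => mdist (val x) (val y) end.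
have dP : is_metric d.
  split.
  - by move=> [x|] //=; rewrite mdistxx.
  - move=> [x|] [y|] //=.
    + by move=> /mdist_positivity/val_inj ->.
    + by move=> gx; have := g_gt0 _ (ssvalP x); rewrite gx ltxx.
    + by move=> gy; have := g_gt0 _ (ssvalP y); rewrite gy ltxx.
  - by move=> [x|] [y|] //=; rewrite metric_sym.
  - move=> [y|] [x|] [z|] //=.
    + exact: metric_triangle.
    + exact: (gK _ _ (ssvalP x) (ssvalP y)).1.
    + by rewrite addrC metric_sym; exact: (gK _ _ (ssvalP z) (ssvalP y)).1.
    + by have := g_ge0 _ (ssvalP y); lra.
    + exact: (gK _ _ (ssvalP x) (ssvalP z)).2.
    + by rewrite ?addr0 ?add0r.
    + by rewrite ?addr0 ?add0r.
pose A : metricType R := metric_of dP.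
pose B : set A := [set a : A | isSome a].
have BP (b : B) : {x : seq_sub s | set_val b = Some x}.
  by case: b => -[x|] bB; [exists x | have := set_mem bB].
pose f (b : B) : U := val (sval (BP b)).
have fi : isometric_embedding f.
  move=> x y; rewrite [RHS]mdist_set_val /f.
  by case: (BP x) => x' ex; case: (BP y) => y' ey /=; rewrite ex ey.
have finA : finite_set [set: A] by exact: (@finite_finset (option (seq_sub s))).
have [h hi hf] := hU finA fi.
exists (h None) => x xs.
have Bx : (Some (SeqSub xs) : A) \in B by rewrite inE.
pose b : B := exist _ (Some (SeqSub xs) : A) Bx.
have fb : f b = x by rewrite /f; case: (BP b) => x' ex /=; have [<-] : Some (SeqSub xs) = Some x' := ex.
by rewrite -{1}fb -hf hi.
Qed.

Lemma min_choice (I : eqType) (c : seq I) (F : I -> R) : c != [::] ->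
  exists2 i, i \in c & forall j, j \in c -> F i <= F j.
Proof.
elim: c => //= i [|j c] IH _.
  by exists i => [|j]; rewrite ?mem_seq1// => /eqP ->.
have [//|k kc kmin] := IH.
have [ik|/ltW ki] := leP (F i) (F k).
  exists i; first by rewrite mem_head.
  by move=> l; rewrite inE => /predU1P[->//|/kmin]; exact: le_trans.
exists k; first by rewrite inE kc orbT.
by move=> l; rewrite inE => /predU1P[->//|/kmin].
Qed.

(* The free amalgam of the prescribed distances [c] with the points of [s]: the
   new point is joined to [s] by shortest paths through the points of [c]. *)
Lemma free_extension (c : seq (R * U)) (s : seq U) : c != [::] ->
  (forall a b, a \in c -> b \in c ->
    a.1 <= mdist a.2 b.2 + b.1 /\ mdist a.2 b.2 <= a.1 + b.1) ->
  exists y, (forall a, a \in c -> mdist y a.2 = a.1) /\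
    forall x, x \in s -> exists2 a, a \in c & mdist y x = a.1 + mdist a.2 x.
Proof.
move=> c0 cK.
have minP x := min_choice (fun a => a.1 + mdist a.2 x) c0.
pose g x := let a := sval (cid2 (minP x)) in a.1 + mdist a.2 x.
have gP x : exists2 a, a \in c & g x = a.1 + mdist a.2 x.
  by rewrite /g; case: cid2 => a /= ac _; exists a.
have g_le x a : a \in c -> g x <= a.1 + mdist a.2 x.
  by rewrite /g; case: cid2 => b /= _ bmin /bmin.
have gc a : a \in c -> g a.2 = a.1.
  move=> ac; apply/eqP; rewrite eq_le; apply/andP; split.
    by apply: le_trans (g_le _ _ ac) _; rewrite mdistxx addr0.
  by have [b bc ->] := gP a.2; have := (cK a b ac bc).1; rewrite metric_sym; lra.
have [x y _ _|y yP] := @katetov_realized (map snd c ++ s) g.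
  have [a ac ga] := gP x; have [b bc gb] := gP y.
  have := g_le x b bc; have := (cK a b ac bc).2.
  have := metric_triangle b.2 y x; have := metric_triangle x a.2 y.
  have := metric_triangle a.2 b.2 y.
  by rewrite (metric_sym x a.2) (metric_sym y x) ga gb; lra.
exists y; split => [a ac|x xs].
  by rewrite yP ?gc// mem_cat map_f.
by have [a ac ga] := gP x; exists a => //; rewrite yP// mem_cat xs orbT.
Qed.

End finite_extension.

(** * Limits and extension of isometries from dense families *)

Section completion.
Context {R : realType} {U : metricType R}.
Hypothesis cU : complete_space U.

Lemma cauchy_limit (y : nat -> U) :
  (forall e, 0 < e -> exists N, forall m n, (N <= m)%N -> (N <= n)%N ->
     mdist (y m) (y n) < e) ->
  exists v, forall e, 0 < e -> exists N, forall n, (N <= n)%N -> mdist (y n) v < e.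
Proof.
move=> yC; have := @cU (y @ \oo) _ _.
case.
  apply/cauchy_exP => e e0; have [N NP] := yC _ e0.
  exists (y N); rewrite ballEmdist; exists N => //= n /= Nn; exact: NP.
move=> v yv; exists v => e e0.
have [N _ NP] := @metricType_numDomainType.cvgr_dist_lt _ U _ _ _ y v yv e e0.
by exists N => n /NP; rewrite metric_sym.
Qed.

Lemma small_inv (e : R) : 0 < e -> exists n : nat, n.+1%:R^-1 < e.
Proof.
move=> e0; exists (Num.truncn e^-1).
by rewrite invf_plt ?posrE ?ltr0n// truncnS_gt.
Qed.

Lemma dist_eq_approx (a b : R) :
  (forall e, 0 < e -> `|a - b| <= e) -> a = b.
Proof.
move=> ab; apply/eqP; rewrite -subr_eq0 -normr_le0; apply/ler_addgt0Pl => e e0.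
by rewrite addr0 ab.
Qed.

(** The value at [u] is a limit of values [y t] with [x t] tending to [u]. Both families are indexed
    by [T], so repetitions in [x] are harmless: equal points have equal images. *)
Lemma isometry_extension (X : metricType R) (T : Type) (x : T -> X) (y : T -> U) :
  (forall u e, 0 < e -> exists t, mdist (x t) u < e) ->
  (forall s t, mdist (y s) (y t) = mdist (x s) (x t)) ->
  exists2 I : X -> U, isometric_embedding I & forall t, I (x t) = y t.
Proof.
move=> xD xy.
have E u : exists v, forall e, 0 < e ->
    exists2 t, mdist (x t) u < e & mdist (y t) v < e.
  have /choice[t tP] (n : nat) : exists t, mdist (x t) u < n.+1%:R^-1.
    by apply: xD; rewrite invr_gt0 ltr0n.
  have tC e : 0 < e -> exists N, forall n, (N <= n)%N -> mdist (x (t n)) u < e.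
    move=> /small_inv[N Ne]; exists N => n Nn; apply: lt_le_trans (tP n) _.
    by apply: le_trans (ltW Ne); rewrite lef_pV2 ?posrE ?ltr0n// ler_nat.
  have [e e0|v vP] := @cauchy_limit (y \o t).
    have [|N NP] := tC (e / 2); first by rewrite divr_gt0.
    exists N => m n Nm Nn; rewrite /= xy; have := NP _ Nm; have := NP _ Nn.
    by have := metric_triangle (x (t m)) u (x (t n)); rewrite (metric_sym u); lra.
  exists v => e e0; have [N NP] := vP _ e0; have [M MP] := tC _ e0.
  exists (t (maxn N M)); first by apply: MP; rewrite leq_maxr.
  by apply: NP; rewrite leq_maxl.
have [I IP] := choice E.
have Ii : isometric_embedding I.
  move=> u v; apply: dist_eq_approx => e e0.
  have e40 : 0 < e / 4 by rewrite divr_gt0.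
  have [s xs ys] := IP u _ e40; have [t xt yt] := IP v _ e40.
  have := metric_triangle (I u) (y s) (I v); have := metric_triangle (y s) (y t) (I v).
  have := metric_triangle (y s) (I u) (y t); have := metric_triangle (I u) (I v) (y t).
  have := metric_triangle u (x s) v; have := metric_triangle (x s) (x t) v.
  have := metric_triangle (x s) u (x t); have := metric_triangle u v (x t).
  rewrite xy (metric_sym v) (metric_sym (I v)) (metric_sym u (x s)).
  by rewrite (metric_sym (I u) (y s)) ler_norml; lra.
exists I => // t; apply: mdist_positivity; apply: dist_eq_approx => e e0.
have [|s xs ys] := IP (x t) (e / 2); first by rewrite divr_gt0.
have := metric_triangle (I (x t)) (y s) (y t).
by rewrite xy (metric_sym (I (x t)) (y s)) subr0 ger0_norm ?mdist_ge0//; lra.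
Qed.

End completion.

(** Surjectivity comes from extending the inverse matching as well: the two extensions are inverse
    to each other on a dense family, hence everywhere. *)
Lemma isometry_of_dense_sequences {R : realType} {U : metricType R}
    (cU : complete_space U) (T : Type) (x y : T -> U) :
  (forall u e, 0 < e -> exists t, mdist (x t) u < e) ->
  (forall u e, 0 < e -> exists t, mdist (y t) u < e) ->
  (forall s t, mdist (y s) (y t) = mdist (x s) (x t)) ->
  exists2 I, Iso U I & forall t, I (x t) = y t.
Proof.
move=> xD yD xy; have [I Ii Ix] := isometry_extension cU xD xy.
have [|J Ji Jy] := isometry_extension cU yD (y := x); first by move=> s t; rewrite xy.
exists I => //; split => //; apply/seteqP; split => // v _; exists (J v) => //.
apply: mdist_positivity; apply: dist_eq_approx => e e0.
have [|t yt] := yD v (e / 2); first by rewrite divr_gt0.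
have := metric_triangle (I (J v)) (y t) v.
have := Ii (J v) (x t); rewrite Ix -(Jy t) Ji => Ivt.
by rewrite Ivt subr0 ger0_norm ?mdist_ge0// (metric_sym v (y t)); lra.
Qed.

Lemma dense_sequence {R : realType} {U : metricType R} (u0 : U) : separable U ->
  exists u : nat -> U, forall v e, 0 < e -> exists n, mdist (u n) v < e.
Proof.
move=> [D cD dD].
have DP v e : 0 < e -> exists2 w, D w & mdist w v < e.
  move=> e0; have := dD (ball v e)° _ (@open_interior _ _).
  case=> [|w [wv Dw]].
    by exists v; exact: nbhsx_ballx.
  by exists w => //; move/interior_subset: wv; rewrite ballEmdist /= metric_sym.
have [w0 Dw0 _] := DP u0 1 ltr01.
move/pfcard_geP: cD => [D0|[g]]; first by move: Dw0; rewrite D0.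
have gD : set_surj setT D g by exact: surj.
exists g => v e e0; have [w Dw wv] := DP v _ e0.
by have [n _ gn] := gD w Dw; exists n; rewrite gn.
Qed.

(** * Katetov frames *)

(** Dependent choice on finite prefixes: [Inv] is what the recursion carries, [Post] what each new
    term satisfies with respect to the prefix before it. *)
Lemma sequence_construction (A : Type) (Inv : seq A -> Prop)
    (Post : seq A -> A -> Prop) :
  Inv [::] -> (forall s, Inv s -> exists y, Post s y /\ Inv (rcons s y)) ->
  exists z : nat -> A, forall n, Inv (mkseq z n) /\ Post (mkseq z n) (z n).
Proof.
move=> I0 step.
have /choice[next nextP] (s : {s | Inv s}) :
    exists y, Post (sval s) y /\ Inv (rcons (sval s) y).
  exact: step (svalP s).
pose G n := iter n (fun s => exist Inv _ (nextP s).2) (exist _ _ I0).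
have GE n : sval (G n) = mkseq (fun n => next (G n)) n.
  by elim: n => //= n IH; rewrite -addn1 /mkseq iotaD map_cat -/(mkseq _ n) -IH cats1.
exists (fun n => next (G n)) => n; rewrite -GE; split; first exact: svalP.
exact: (nextP (G n)).1.
Qed.

Section back_and_forth.
Variables (Q : nat -> nat -> Prop) (C : nat * nat -> nat * nat -> Prop).
Hypothesis Crefl : forall a, C a a.
Hypothesis Csym : forall a b, C a b -> C b a.

Let good (s : seq (nat * nat)) :=
  (forall a, a \in s -> Q a.1 a.2) /\
  (forall a b, a \in s -> b \in s -> C a b).

Lemma back_and_forth :
  (forall s, good s -> forall m, exists n, Q m n /\ forall a, a \in s -> C a (m, n)) ->
  (forall s, good s -> forall n, exists m, Q m n /\ forall a, a \in s -> C a (m, n)) ->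
  exists x y : nat -> nat,
    [/\ forall n, Q (x n) (y n),
        forall m n, C (x m, y m) (x n, y n),
        forall m, exists n, x n = m &
        forall m, exists n, y n = m].
Proof.
move=> forth back.
have goodS s a : good s -> Q a.1 a.2 -> (forall b, b \in s -> C b a) ->
    good (rcons s a).
  move=> [sQ sC] aQ aC; split => [b|b c].
    by rewrite mem_rcons inE => /predU1P[->|/sQ].
  rewrite !mem_rcons !inE => /predU1P[->|bs] /predU1P[->|cs] //.
  - exact/Csym/aC.
  - exact: aC.
  - exact: sC.
(* Stage [2n] takes care of [n] as a first coordinate, stage [2n + 1] as a second one. *)
pose Post (s : seq (nat * nat)) a :=
  (forall n, size s = n.*2 -> a.1 = n) /\ (forall n, size s = n.*2.+1 -> a.2 = n).
have [//|s gs|z zP] := @sequence_construction _ good Post.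
  have [so|se] := boolP (odd (size s)).
    have [m [mQ mC]] := back _ gs (size s)./2; exists (m, (size s)./2).
    by split; [split=> n sn; rewrite sn /=; move: so; rewrite sn ?uphalf_double ?odd_double|exact: goodS].
  have [m [mQ mC]] := forth _ gs (size s)./2; exists ((size s)./2, m).
  split; last exact: goodS.
  by split=> n sn /=; move: se; rewrite sn ?doubleK //= odd_double.
have zin m n : (m < n)%N -> z m \in mkseq z n.
  by move=> mn; apply/mapP; exists m; rewrite ?mem_iota.
exists (fun n => (z n).1), (fun n => (z n).2); split.
- by move=> n; have [[+ _] _] := zP n.+1; apply; exact: zin.
- move=> m n; have [[_ +] _] := zP (maxn m n).+1 => /(_ (z m) (z n)).
  by rewrite -!surjective_pairing; apply; apply: zin; rewrite ltnS ?leq_maxl ?leq_maxr.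
- by move=> m; exists m.*2; have [_ [+ _]] := zP m.*2; apply; rewrite size_mkseq.
- by move=> m; exists m.*2.+1; have [_ [_ +]] := zP m.*2.+1; apply; rewrite size_mkseq.
Qed.

End back_and_forth.

(** A dummy tag [k] makes every task [c] occur at arbitrarily late stages of a construction, in
    particular after all the points that it mentions. *)
Lemma pickle_unbounded (T : countType) (c : T) (b : nat) :
  exists k : nat, (b <= pickle (k, c))%N.
Proof.
apply: contrapT => /forallNP kb.
have f_inj : injective (fun k : nat => pickle (k, c)).
  by move=> i j /(pcan_inj pickleK)[].
have : (size (map (fun k : nat => pickle (k, c)) (iota 0 b.+1)) <= size (iota 0 b))%N.
  apply: uniq_leq_size; first by rewrite map_inj_uniq// iota_uniq.
  by move=> _ /mapP[k _ ->]; rewrite mem_iota add0n ltnNge; apply/negP/kb.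
by rewrite size_map !size_iota ltnn.
Qed.

Record is_pseudometric {R : realFieldType} (T : Type) (d : T -> T -> R) : Prop :=
IsPseudometric {
  is_pseudometricxx : forall x, d x x = 0;
  is_pseudometric_sym : forall x y, d x y = d y x;
  is_pseudometric_tri : forall y x z, d x z <= d x y + d y z
}.

Definition is_rational {R : realType} (x : R) := exists q : rat, x = ratr q.

Lemma is_rationalD {R : realType} (x y : R) : is_rational x -> is_rational y -> is_rational (x + y).
Proof. by move=> [p ->] [q ->]; exists (p + q); rewrite rmorphD. Qed.

Lemma is_rational0 {R : realType} : is_rational (0 : R).
Proof. by exists 0; rewrite rmorph0. Qed.

(* A countable dense set [z] of [U] containing a copy [z \o idx] of [(T, d)], all
   of whose points have finite support over that copy as in Katetov's
   construction. *)
Record katetov_frame {R : realType} {U : metricType R} {T : eqType}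
    (d : T -> T -> rat) (z : nat -> U) (idx : T -> nat) : Prop := KatetovFrame {
  frame_dense : forall u (e : R), 0 < e -> exists m, mdist (z m) u < e;
  frame_rational : forall m n, is_rational (mdist (z m) (z n));
  frame_isometric : forall s t, mdist (z (idx s)) (z (idx t)) = ratr (d s t);
  frame_free : forall c : seq (rat * nat), c != [::] ->
    (forall a b, a \in c -> b \in c ->
      ratr a.1 <= mdist (z a.2) (z b.2) + ratr b.1 /\
      mdist (z a.2) (z b.2) <= ratr a.1 + ratr b.1) ->
    exists m, (forall a, a \in c -> mdist (z m) (z a.2) = ratr a.1) /\
      forall t, exists2 a, a \in c &
        mdist (z m) (z (idx t)) = ratr a.1 + mdist (z a.2) (z (idx t));
  frame_support : forall m, exists2 c : seq T, c != [::] &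
    forall t, exists2 s, s \in c & mdist (z m) (z (idx t)) =
      mdist (z m) (z (idx s)) + mdist (z (idx s)) (z (idx t))
}.

Section frame_construction.
Context {R : realType} {U : metricType R}.
Hypothesis hU : finite_extension_property U.

(** When [u] is far from [s], its distances are rounded up to rationals [q] and then replaced by
    shortest paths through [s]. This makes them a Katetov function, still rational and within
    [e / 2] of the original, which can also prescribe the distance [e / 2] to [u]. *)
Lemma rational_approximation (s : seq U) (u : U) (e : R) : 0 < e -> s != [::] ->
  (forall x y, x \in s -> y \in s -> is_rational (mdist x y)) ->
  exists2 y, mdist y u < e & forall x, x \in s -> is_rational (mdist y x).
Proof.
move=> e0 s0 sr.
have [[x xs xu]|far] := pselect (exists2 x, x \in s & mdist x u < e).
  by exists x => // y ys; exact: sr.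
have {}far x : x \in s -> e <= mdist x u.
  by move=> xs; rewrite leNgt; apply/negP => xu; apply: far; exists x.
have /choice[q qP] (x : U) : exists q : rat, mdist x u < ratr q < mdist x u + e / 2.
  by have [|q] := @rat_in_itvoo _ (mdist x u) (mdist x u + e / 2);
    [lra|rewrite in_itv => ?; exists q].
have minP x := min_choice (fun a => ratr (q a) + mdist a x) s0.
pose g x := if x == u then e / 2
            else let a := sval (cid2 (minP x)) in ratr (q a) + mdist a x.
have us : u \notin s by apply/negP => /far; rewrite mdistxx; lra.
have gP x : x \in s -> exists2 a, a \in s & g x = ratr (q a) + mdist a x.
  move=> xs; rewrite /g ifN; last by apply: contraNneq us => <-.
  by case: cid2 => a /= ac _; exists a.
have g_le x a : x \in s -> a \in s -> g x <= ratr (q a) + mdist a x.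
  move=> xs ac; rewrite /g ifN; last by apply: contraNneq us => <-.
  by case: cid2 => b /= bs; exact.
have gu : g u = e / 2 by rewrite /g eqxx.
have g_itv x : x \in s -> mdist x u <= g x <= mdist x u + e / 2.
  move=> xs; have := g_le _ _ xs xs; have [a ac ga] := gP _ xs.
  have := qP x; have := qP a; have := metric_triangle x a u.
  by rewrite mdistxx (metric_sym x a); lra.
have [x y|y yP] := katetov_realized hU (s := u :: s) (g := g).
  rewrite !inE => /predU1P[->|xs] /predU1P[->|ys].
  - by rewrite mdistxx; lra.
  - by have := g_itv _ ys; have := far _ ys; rewrite (metric_sym u) gu; lra.
  - by have := g_itv _ xs; have := far _ xs; rewrite gu; lra.
  - have [a ac ga] := gP _ xs; have [b bc gb] := gP _ ys.
    have := g_le x b xs bc; have := g_itv _ xs; have := g_itv _ ys.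
    have := metric_triangle b y x; have := metric_triangle x u y.
    by rewrite (metric_sym y x) (metric_sym u y) gb; lra.
exists y; first by rewrite yP ?mem_head// gu; lra.
move=> x xs; rewrite yP ?inE ?xs ?orbT//; have [a ac ->] := gP x xs.
by apply: is_rationalD; [exists (q a)|exact: sr].
Qed.

Variables (T : countType) (t0 : T) (d : T -> T -> rat).
Hypothesis dP : is_pseudometric d.

(** Numbers that code nothing stand for [t0]; this only repeats a point, which a pseudometric
    allows. *)
Let enum n := odflt t0 (unpickle n).
Let dn m n : R := ratr (d (enum m) (enum n)).

Let dnC m n : dn m n = dn n m.
Proof. by rewrite /dn is_pseudometric_sym. Qed.

Let dn_tri n m k : dn m k <= dn m n + dn n k.
Proof. by rewrite /dn -rmorphD /= ler_rat is_pseudometric_tri. Qed.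

Let dnxx n : dn n n = 0.
Proof. by rewrite /dn is_pseudometricxx// rmorph0. Qed.

Variables (u0 : U) (u : nat -> U).
Hypothesis uP : forall v (e : R), 0 < e -> exists n, mdist (u n) v < e.

Let valid (s : seq U) (c : seq (rat * nat)) :=
  [/\ c != [::], forall a, a \in c -> (a.2 < size s)%N &
    forall a b, a \in c -> b \in c ->
      ratr a.1 <= mdist (nth u0 s a.2) (nth u0 s b.2) + ratr b.1 /\
      mdist (nth u0 s a.2) (nth u0 s b.2) <= ratr a.1 + ratr b.1 :> R].

Let Inv (s : seq U) :=
  (forall x y, x \in s -> y \in s -> is_rational (mdist x y)) /\
  (forall i j, (3 * i < size s)%N -> (3 * j < size s)%N ->
    mdist (nth u0 s (3 * i)) (nth u0 s (3 * j)) = dn i j).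

(** Three kinds of stages. At [3n] the [n]-th point of the copy of [T] is added, as free as possible
    over the past; at [3n + 1] the sequence is made dense, [n] coding a point [u m] and a precision;
    at [3n + 2] the finite Katetov function coded by [n] is realized. *)
Let Post (s : seq U) (y : U) :=
  [/\ forall n, size s = (3 * n)%N -> (0 < n)%N -> forall x, x \in s ->
        exists2 k, (k < n)%N & mdist y x = dn n k + mdist (nth u0 s (3 * k)) x,
      forall n m k, size s = (3 * n + 1)%N -> unpickle n = Some (m, k) ->
        mdist y (u m) < k.+1%:R^-1 &
      forall n (k : nat) c, size s = (3 * n + 2)%N -> unpickle n = Some (k, c) ->
        valid s c -> (forall a, a \in c -> mdist y (nth u0 s a.2) = ratr a.1) /\
          forall x, x \in s -> exists2 a, a \in c &
            mdist y x = ratr a.1 + mdist (nth u0 s a.2) x].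

Let InvS s y : Inv s -> (forall x, x \in s -> is_rational (mdist y x)) ->
  (forall n, size s = (3 * n)%N -> forall k, (k < n)%N ->
    mdist y (nth u0 s (3 * k)) = dn n k) -> Inv (rcons s y).
Proof.
move=> [sr si] yr yi; split.
  move=> v w; rewrite !mem_rcons !inE => /predU1P[->|vs] /predU1P[->|ws].
  - by rewrite mdistxx; exact: is_rational0.
  - exact: yr.
  - by rewrite metric_sym; exact: yr.
  - exact: sr.
move=> i j; rewrite size_rcons !ltnS !nth_rcons.
case: (ltngtP (3 * i) (size s))%N => // si' _.
  case: (ltngtP (3 * j) (size s))%N => // sj' _; first exact: si.
  by rewrite metric_sym dnC (yi j)//; lia.
case: (ltngtP (3 * j) (size s))%N => // sj' _.
  by rewrite (yi i)//; lia.
have ij : i = j by lia.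
by rewrite ij mdistxx dnxx.
Qed.

Let step s : Inv s -> exists y, Post s y /\ Inv (rcons s y).
Proof.
move=> Is; have [sr si] := Is; have : (size s %% 3 < 3)%N by rewrite ltn_mod.
have := divn_eq (size s) 3; set n := (size s %/ 3)%N.
(* For stages whose number codes no valid task: an old point is repeated. *)
have triv : s != [::] -> exists2 y, y \in s & forall x, x \in s -> is_rational (mdist y x).
  by case: (s) sr => // a l sr' _; exists a; [|move=> x xs; apply: sr'];
    rewrite ?mem_head.
case: (size s %% 3)%N => [|[|[|//]]] sE _.
- have [n0|n_gt0] := posnP n.
    have s0 : s = [::] by apply: size0nil; lia.
    exists u0; split; first by split=> [k|k m i|k m c]; lia.
    by apply: InvS => // [x|k]; [rewrite s0|lia].
  pose c := [seq (dn n k, nth u0 s (3 * k)) | k <- iota 0 n].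
  have [||y [yc ys]] := free_extension hU (c := c) s.
  + by rewrite -size_eq0 size_map size_iota; lia.
  + move=> _ _ /mapP[i + ->] /mapP[j + ->]; rewrite !mem_iota /= !add0n => iN jN.
    rewrite si; [|lia|lia].
    by have := dn_tri j n i; have := dn_tri n i j; rewrite (dnC j i) (dnC i n); lra.
  have yc' k : (k < n)%N -> mdist y (nth u0 s (3 * k)) = dn n k.
    by move=> kn; apply: (yc (_, _)); apply/mapP; exists k; rewrite // mem_iota.
  have ys' x : x \in s ->
      exists2 k, (k < n)%N & mdist y x = dn n k + mdist (nth u0 s (3 * k)) x.
    by move=> /ys[_ /mapP[k + ->]]; rewrite mem_iota => kn yx; exists k.
  exists y; split.
    split; [|by lia|by lia] => k sk _ x xs.
    have -> : k = n by lia.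
    exact: ys'.
  apply: InvS => // [x xs|k sk].
    have [k kn ->] := ys' x xs; apply: is_rationalD; first by eexists.
    by apply: sr => //; rewrite mem_nth// sE; lia.
  have -> : k = n by lia.
  exact: yc'.
- have s0 : s != [::] by rewrite -size_eq0 sE; lia.
  have [[[m k] nE]|nN] : (exists mk : nat * nat, unpickle n = Some mk) \/
      (forall mk : nat * nat, unpickle n <> Some mk).
    by case: (unpickle n) => [mk|]; [left; exists mk|right].
  + have k0 : 0 < k.+1%:R^-1 :> R by rewrite invr_gt0 ltr0n.
    have [y yu yr] := rational_approximation (u m) k0 s0 sr.
    exists y; split.
      split=> [i|i m' k' si'|i]; [lia| |lia].
      have -> : i = n by lia.
      by rewrite nE => -[<- <-].
    by apply: InvS => // i; lia.
  + have [y ys yr] := triv s0; exists y; split.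
      split=> [i|i m' k' si'|i]; [lia| |lia].
      have -> : i = n by lia.
      by move=> /nN.
    by apply: InvS => // i; lia.
- have s0 : s != [::] by rewrite -size_eq0 sE; lia.
  have [[[k c] nE cV]|nN] : (exists2 kc : nat * seq (rat * nat),
      unpickle n = Some kc & valid s kc.2) \/
      (forall kc : nat * seq (rat * nat), unpickle n = Some kc -> ~ valid s kc.2).
    have [?|N] := pselect (exists2 kc : nat * seq (rat * nat),
      unpickle n = Some kc & valid s kc.2); first by left.
    by right=> kc nE cV; apply: N; exists kc.
  + have [c0 cs cK] := cV.
    pose c' : seq (R * U) := [seq (ratr a.1, nth u0 s a.2) | a <- c].
    have [||y [yc ys]] := free_extension hU (c := c') s.
    * by rewrite -size_eq0 size_map size_eq0.
    * by move=> _ _ /mapP[a ac ->] /mapP[b bc ->]; exact: cK.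
    have yc2 a : a \in c -> mdist y (nth u0 s a.2) = ratr a.1.
      by move=> ac; apply: (yc (_, _)); apply/mapP; exists a.
    have ys2 x : x \in s -> exists2 a, a \in c &
        mdist y x = ratr a.1 + mdist (nth u0 s a.2) x.
      by move=> /ys[_ /mapP[a ac ->]] yx; exists a.
    exists y; split.
      split=> [i|i|i k' c'' si']; [lia|lia|].
      have -> : i = n by lia.
      by rewrite nE => -[_ <-] _; split.
    apply: InvS => // [x xs|i]; last by lia.
    have [a ac ->] := ys2 x xs; apply: is_rationalD; first by exists a.1.
    by apply: sr => //; rewrite mem_nth// cs.
  + have [y ys yr] := triv s0; exists y; split.
      split=> [i|i|i k' c'' si']; [lia|lia|].
      have -> : i = n by lia.
      by move=> /nN.
    by apply: InvS => // i; lia.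
Qed.

(** The key is [free]: every point older than [z (3 * n)] reaches it by a shortest path through an
    older point of the copy, so questions about the whole copy descend to finitely many of its
    points. *)
Lemma katetov_frame_exists :
  exists (z : nat -> U) (idx : T -> nat), katetov_frame d z idx.
Proof.
have [|z zP] := sequence_construction (Inv := Inv) (Post := Post) _ step.
  by split.
have nthz i n : (i < n)%N -> nth u0 (mkseq z n) i = z i by exact: nth_mkseq.
have zin i n : (i < n)%N -> z i \in mkseq z n.
  by move=> mn; apply/mapP; exists i; rewrite ?mem_iota.
have iso i j : mdist (z (3 * i)%N) (z (3 * j)%N) = dn i j.
  have [[_ +] _] := zP (3 * (i + j)).+1.
  by move=> /(_ i j); rewrite size_mkseq !nthz//; [apply|..]; lia.
have free n i : (i < 3 * n)%N -> exists2 k, (k < n)%N &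
    mdist (z i) (z (3 * n)%N) = mdist (z i) (z (3 * k)%N) + mdist (z (3 * k)%N) (z (3 * n)%N).
  move=> i3n; have [_ [+ _ _]] := zP (3 * n)%N.
  rewrite size_mkseq => /(_ n erefl) H.
  have n0 : (0 < n)%N by lia.
  have [k kn] := H n0 _ (zin _ _ i3n).
  rewrite nthz; last by lia.
  move=> e; exists k => //; rewrite iso dnC addrC (metric_sym (z i) (z (3 * k)%N)) -e.
  exact: metric_sym.
pose idx (t : T) := (3 * pickle t)%N.
have enumK t : enum (pickle t) = t by rewrite /enum pickleK.
have zidx k : z (idx (enum k)) = z (3 * k)%N.
  by apply: mdist_positivity; rewrite iso /dn enumK is_pseudometricxx// rmorph0.
exists z, idx; split.
- move=> v e e0; have [m mv] := uP v (divr_gt0 e0 (ltr0n R 2)).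
  have [k ke] := small_inv (divr_gt0 e0 (ltr0n R 2)).
  set n := pickle (m, k); exists (3 * n + 1)%N.
  have [_ [_ /(_ n m k) + _]] := zP (3 * n + 1)%N.
  rewrite size_mkseq pickleK => /(_ erefl erefl)/lt_trans/(_ ke).
  by have := metric_triangle (z (3 * n + 1)%N) (u m) v; lra.
- move=> m n; have [[+ _] _] := zP (m + n).+1; apply; apply: zin; lia.
- by move=> s t; rewrite iso /dn !enumK.
- move=> c c0 cK.
  pose B := \max_(a <- c) a.2.+1.
  have [k Bk] := pickle_unbounded c B.
  set n := pickle (k, c) in Bk; have [_ [_ _ /(_ n k c)]] := zP (3 * n + 2)%N.
  have cn a : a \in c -> (a.2 < 3 * n + 2)%N.
    move=> ac; have : (a.2.+1 <= B)%N by exact: (@leq_bigmax_seq _ c xpredT (fun a => a.2.+1) a).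
    lia.
  rewrite size_mkseq pickleK => /(_ erefl erefl)[|zc zfree].
    split=> // [a|a b ac bc]; rewrite ?size_mkseq; first exact: cn.
    by rewrite !nthz ?cn//; exact: cK.
  have {}zc a : a \in c -> mdist (z (3 * n + 2)%N) (z a.2) = ratr a.1.
    by move=> ac; rewrite -zc// nthz ?cn.
  exists (3 * n + 2)%N; split=> // t; rewrite /idx.
  (* Points of the copy older than the new point are covered by [zfree]; a younger one is reached
     through an older one, to which the induction hypothesis applies. *)
  elim/ltn_ind: (pickle t) => m IH.
  have [mn|nm] := ltnP (3 * m)%N (3 * n + 2)%N.
    by have [a ac ->] := zfree _ (zin _ _ mn); exists a => //; rewrite nthz ?cn.
  have [|i im zi] := free m (3 * n + 2)%N; first by lia.
  have [a ac ai] := IH i im; exists a => //.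
  have := metric_triangle (z a.2) (z (3 * i)%N) (z (3 * m)%N).
  have := metric_triangle (z (3 * n + 2)%N) (z a.2) (z (3 * m)%N).
  by rewrite zc//; lra.
(* The first [n + 1] points of the copy support [z n], because each later one was added after
   [z n]. *)
- move=> n; exists [seq enum k | k <- iota 0 n.+1] => // t.
  suff [k kn zk] : exists2 k, (k < n.+1)%N & mdist (z n) (z (idx t)) =
      mdist (z n) (z (3 * k)%N) + mdist (z (3 * k)%N) (z (idx t)).
    by exists (enum k); [apply/mapP; exists k; rewrite // mem_iota|rewrite zidx].
  rewrite /idx; elim/ltn_ind: (pickle t) => m IH.
  have [mn|nm] := ltnP m n.+1; first by exists m; rewrite // mdistxx addr0.
  have [|i im zi] := free m n; first by lia.
  have [k kn zk] := IH i im; exists k => //.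
  have := metric_triangle (z (3 * k)%N) (z (3 * i)%N) (z (3 * m)%N).
  have := metric_triangle (z n) (z (3 * k)%N) (z (3 * m)%N); lra.
Qed.

End frame_construction.

(* Back and forth: finite supports make the extension of a finite partial
   isometry commuting with [s] on the copy of [T] a finite problem. *)
Lemma frame_isometry {R : realType} {U : metricType R} (cU : complete_space U)
    (T : eqType) (d : T -> T -> rat) (z : nat -> U) (idx : T -> nat) (s s' : T -> T) :
  katetov_frame d z idx -> cancel s s' -> cancel s' s ->
  (forall x y, d (s x) (s y) = d x y) ->
  exists2 I, Iso U I & forall t, I (z (idx t)) = z (idx (s t)).
Proof.
move=> [zD zr zi zfree zsupp].
pose p t := z (idx t).
pose C (a b : nat * nat) := mdist (z a.1) (z b.1) = mdist (z a.2) (z b.2).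
pose Q (s : T -> T) m n := forall t, mdist (z m) (p t) = mdist (z n) (p (s t)).
have ext (r : T -> T) : (forall x y, d (r x) (r y) = d x y) ->
    forall l : seq (nat * nat), (forall a, a \in l -> Q r a.1 a.2) ->
    (forall a b, a \in l -> b \in l -> C a b) ->
    forall m, exists n, Q r m n /\ forall a, a \in l -> C a (m, n).
  move=> ri l lQ lC m; have [c c0 cP] := zsupp m.
  have /choice[q qP] (k : nat) : exists q : rat, mdist (z m) (z k) = ratr q := zr m k.
  (* The support of [z m], with its image under [r], joins the finite partial isometry; this
     controls the distances of the new point to the whole copy. *)
  pose c1 := [seq (idx t, idx (r t)) | t <- c].
  have c1Q a : a \in c1 ++ l -> Q r a.1 a.2.
    rewrite mem_cat => /orP[/mapP[t _ ->]|/lQ//] t'.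
    by rewrite /p !zi ri.
  have c1C a b : a \in c1 ++ l -> b \in c1 ++ l -> C a b.
    move=> ac bc; have Qa := c1Q _ ac; have Qb := c1Q _ bc.
    move: ac bc; rewrite !mem_cat => /orP[/mapP[t _ ->] _|al].
      by rewrite /C metric_sym -/(p t) Qb metric_sym.
    move=> /orP[/mapP[t _ ->]|bl]; last exact: lC.
    exact: Qa.
  have [||n [n1 n2]] := zfree [seq (q a.1, a.2) | a <- c1 ++ l].
  - by rewrite -size_eq0 size_map size_cat size_map addn_eq0 size_eq0 (negPf c0).
  - move=> _ _ /mapP[a ac ->] /mapP[b bc ->] /=; rewrite -!qP -(c1C a b ac bc).
    have := metric_triangle (z m) (z b.1) (z a.1).
    have := metric_triangle (z a.1) (z m) (z b.1).
    by rewrite (metric_sym (z a.1) (z m)) (metric_sym (z b.1) (z a.1)); lra.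
  have {}n1 a : a \in c1 ++ l -> mdist (z n) (z a.2) = mdist (z m) (z a.1).
    by move=> ac; rewrite qP; apply: (n1 (_, _)); apply/mapP; exists a.
  exists n; split=> [t|a al]; last first.
    by rewrite /C /= metric_sym -n1 1?metric_sym// mem_cat al orbT.
  (* Freeness of [z n] bounds its distance to [p (r t)] from below by that of [z m] to [p t];
     passing through the support of [z m] gives the reverse bound. *)
  have [_ /mapP[a ac ->]] := n2 (r t); rewrite -qP /= -/(p _) => nrt.
  have [k kc mt] := cP t; have kc1 : (idx k, idx (r k)) \in c1 ++ l.
    by rewrite mem_cat map_f.
  have := n1 _ kc1; rewrite /= => nrk.
  have := c1Q _ ac t; have := metric_triangle (z m) (z a.1) (p t).
  have := metric_triangle (z n) (p (r k)) (p (r t)).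
  by move: mt; rewrite -!/(p _) nrk /p !zi ri; lra.
move=> sK s'K si.
have s'i x y : d (s' x) (s' y) = d x y by rewrite -si !s'K.
have Q' m n : Q s m n <-> Q s' n m.
  split=> H t; first by rewrite (H (s' t)) s'K.
  by rewrite (H (s t)) sK.
have [a|a b|l [lQ lC] m|l [lQ lC] n|x [y [xyQ xyC xS yS]]] :=
  @back_and_forth (Q s) C.
- by rewrite /C !mdistxx.
- by rewrite /C (metric_sym (z b.1)) (metric_sym (z b.2)).
- exact: ext.
(* The back step is the forth step for the inverse [s'], with all pairs swapped. *)
- have [||m [mQ mC]] := ext s' s'i [seq (a.2, a.1) | a <- l] _ _ n.
  + by move=> _ /mapP[a al ->] /=; apply/Q'/lQ.
  + by move=> _ _ /mapP[a al ->] /mapP[b bl ->]; rewrite /C /= (lC a b al bl).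
  exists m; split; first exact/Q'.
  move=> a al; have := mC (a.2, a.1); rewrite /C /= => ->//.
  by apply/mapP; exists a.
have dense (w : nat -> nat) : (forall m, exists n, w n = m) ->
    forall u e, 0 < e -> exists n, mdist (z (w n)) u < e.
  by move=> wS u e /(zD u)[m]; have [n <-] := wS m; exists n.
have [I IU Ixy] := isometry_of_dense_sequences cU (dense x xS) (dense y yS)
  (fun m n => esym (xyC m n)).
exists I => // t; have [n xn] := xS (idx t); rewrite -xn Ixy.
by apply: mdist_positivity; rewrite -xyQ xn mdistxx.
Qed.

(** * Correspondences and the Wijsman topology *)

Section hausdorff.
Context {R : realType} {X : metricType R}.
Implicit Types A B : set X.

Lemma edist_inf_lt A x (e : R) :
  (edist_inf A x < e%:E)%E -> exists2 a, A a & mdist x a < e.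
Proof.
by move=> /ereal_inf_lt[_ [a Aa <-]]; rewrite edist_mdist lte_fin; exists a.
Qed.

Lemma edist_inf_le A x a : A a -> (edist_inf A x <= (mdist x a)%:E)%E.
Proof. by move=> Aa; rewrite -edist_mdist; apply: ereal_inf_lbound; exists a. Qed.

Lemma hausdorff_dist_lt A B (e : R) : (hausdorff_dist A B < e%:E)%E ->
  (forall a, A a -> exists2 b, B b & mdist a b < e) /\
  (forall b, B b -> exists2 a, A a & mdist a b < e).
Proof.
rewrite /hausdorff_dist gt_max => /andP[AB BA]; split => [a Aa|b Bb].
  apply: edist_inf_lt; apply: le_lt_trans AB.
  by apply: ereal_sup_ubound; exists a.
have [|a Aa ab] := @edist_inf_lt A b e; last by exists a; rewrite // metric_sym.
by apply: le_lt_trans BA; apply: ereal_sup_ubound; exists b.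
Qed.

Lemma hausdorff_dist_le A B (e : R) :
  (forall a, A a -> exists2 b, B b & mdist a b <= e) ->
  (forall b, B b -> exists2 a, A a & mdist a b <= e) ->
  (hausdorff_dist A B <= e%:E)%E.
Proof.
move=> AB BA; rewrite /hausdorff_dist ge_max; apply/andP; split.
  apply: ge_ereal_sup => _ [a Aa <-]; have [b Bb ab] := AB a Aa.
  by apply: le_trans (edist_inf_le _ Bb) _; rewrite lee_fin.
apply: ge_ereal_sup => _ [b Bb <-]; have [a Aa ab] := BA b Bb.
by apply: le_trans (edist_inf_le _ Aa) _; rewrite lee_fin metric_sym.
Qed.

Lemma closure_dist A x : closure A x <->
  forall e : R, 0 < e -> exists2 a, A a & mdist x a < e.
Proof.
split=> [Ax e e0|H B /nbhs_ballP[e /= e0]].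
  have [|a [Aa]] := Ax (ball x e); first exact: nbhsx_ballx.
  by rewrite ballEmdist; exists a.
rewrite ballEmdist => xB; have [a Aa xa] := H e e0.
by exists a; split => //; exact: xB.
Qed.

Lemma closed_dist A x : closed A ->
  (forall e : R, 0 < e -> exists2 a, A a & mdist x a < e) -> A x.
Proof. by move=> Ac /closure_dist; exact: Ac. Qed.

Lemma dist_to_lt x (F : nonempty_closed X) (e : R) :
  dist_to x F < e <-> exists2 a, closed_val F a & mdist x a < e.
Proof.
have [a0 Fa0] := closed_val_neq0 F.
have fin : edist_inf F x \is a fin_num.
  rewrite ge0_fin_numE ?edist_inf_ge0//.
  exact: le_lt_trans (edist_inf_le x Fa0) (ltry _).
split=> [|[a Fa xa]]; first by rewrite -lte_fin /dist_to fineK//; exact: edist_inf_lt.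
rewrite -lte_fin /dist_to fineK//; apply: le_lt_trans (edist_inf_le x Fa) _.
by rewrite lte_fin.
Qed.

Lemma dist_to_triangle x y (F : nonempty_closed X) :
  dist_to x F <= mdist x y + dist_to y F.
Proof.
apply/ler_addgt0Pr => e e0.
have /dist_to_lt[a Fa ya] : dist_to y F < dist_to y F + e by lra.
have /dist_to_lt : exists2 a, closed_val F a & mdist x a < mdist x y + dist_to y F + e.
  by exists a => //; have := metric_triangle x y a; lra.
exact: ltW.
Qed.

Lemma dist_to_near x y (F : nonempty_closed X) :
  `|dist_to x F - dist_to y F| <= mdist x y.
Proof.
have := dist_to_triangle x y F; have := dist_to_triangle y x F.
by rewrite (metric_sym y x) ler_norml; lra.
Qed.

End hausdorff.

Section gromov_hausdorff.
Context {R : realType} {X : metricType R}.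
Implicit Types A B : nonempty_closed X.

(** Points are related when their images in a common space [Z] are closer than [e]; the two ends of
    a distance each contribute [e] to the distortion. *)
Lemma GH_correspondence A B (e : R) : (GH A B < e%:E)%E ->
  exists S : X -> X -> Prop,
    [/\ forall a, closed_val A a -> exists2 b, closed_val B b & S a b,
        forall b, closed_val B b -> exists2 a, closed_val A a & S a b &
        forall a b a' b', S a b -> S a' b' ->
          `|mdist a a' - mdist b b'| < e + e].
Proof.
move=> /ereal_inf_lt[_ [Z [i [j [iI jI ->]]]]] /hausdorff_dist_lt[AB BA].
exists (fun a b => exists (a' : set_type A) (b' : set_type B),
  [/\ set_val a' = a, set_val b' = b & mdist (i a') (j b') < e]); split.
- move=> a Aa; pose a' : set_type A := exist _ a (mem_set Aa).
  have [|_ [b' _ <-] ab] := AB (i a'); first by exists a'.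
  by exists (set_val b'); [exact: set_valP|exists a', b'].
- move=> b Bb; pose b' : set_type B := exist _ b (mem_set Bb).
  have [|_ [a' _ <-] ab] := BA (j b'); first by exists b'.
  by exists (set_val a'); [exact: set_valP|exists a', b'].
- move=> _ _ _ _ [a [b [<- <- ab]]] [a' [b' [<- <- ab']]].
  rewrite -!mdist_set_val -iI -jI.
  have := metric_triangle (i a) (j b) (i a'); have := metric_triangle (j b) (j b') (i a').
  have := metric_triangle (j b) (i a) (j b'); have := metric_triangle (i a) (i a') (j b').
  by rewrite (metric_sym (j b) (i a)) (metric_sym (j b') (i a')) ltr_norml; lra.
Qed.

(* The two sets are glued along the correspondence, paired points being put at
   distance [e / 2]; then [e / 4] absorbs the lack of totality. *)
Lemma correspondence_GH A B (S : X -> X -> Prop) (e : R) : 0 < e ->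
  (forall a d, closed_val A a -> 0 < d -> exists p q, [/\ closed_val B q, S p q & mdist a p < d]) ->
  (forall b d, closed_val B b -> 0 < d -> exists p q, [/\ closed_val A p, S p q & mdist q b < d]) ->
  (forall p q p' q', S p q -> S p' q' -> `|mdist p p' - mdist q q'| <= e) ->
  (GH A B <= e%:E)%E.
Proof.
move=> e0 AS BS Sdis.
have [p0 [q0 S0]] : exists p q, S p q.
  have [a Aa] := closed_val_neq0 A.
  by have [p [q [_ pq _]]] := AS a 1 Aa ltr01; exists p, q.
have dis p q p' q' : S p q -> S p' q' ->
    mdist p p' <= mdist q q' + e /\ mdist q q' <= mdist p p' + e.
  by move=> pq pq'; have := Sdis _ _ _ _ pq pq'; rewrite ler_norml; lra.
pose E a b := [set r | exists p q, S p q /\ r = mdist a p + e / 2 + mdist q b].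
pose D a b := inf (E a b).
have D_le a b p q : S p q -> D a b <= mdist a p + e / 2 + mdist q b.
  move=> pq; apply: ge_inf; last by exists p, q.
  exists 0 => _ [p' [q' [_ ->]]].
  by have := mdist_ge0 a p'; have := mdist_ge0 q' b; lra.
have D_ge a b c : (forall p q, S p q -> c <= mdist a p + e / 2 + mdist q b) ->
    c <= D a b.
  move=> H; apply: lb_le_inf; first by eexists; exists p0, q0.
  by move=> _ [p [q [pq ->]]]; exact: H.
have D_gt0 a b : 0 < D a b.
  apply: lt_le_trans (_ : e / 2 <= _); first by lra.
  by apply: D_ge => p q _; have := mdist_ge0 a p; have := mdist_ge0 q b; lra.
have D_tril a a' b : D a b <= mdist a a' + D a' b.
  rewrite -lerBlDl; apply: D_ge => p q pq; have := D_le a b _ _ pq.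
  by have := metric_triangle a a' p; lra.
have D_trir a b b' : D a b <= D a b' + mdist b b'.
  rewrite -lerBlDr; apply: D_ge => p q pq; have := D_le a b _ _ pq.
  by have := metric_triangle q b' b; rewrite (metric_sym b b'); lra.
have D_A a a' b : mdist a a' <= D a b + D a' b.
  rewrite -lerBlDr; apply: (D_ge) => p q pq; rewrite lerBlDl -lerBlDr.
  apply: D_ge => p' q' pq'; have [dpq _] := dis _ _ _ _ pq pq'.
  have := metric_triangle a p a'; have := metric_triangle p p' a'.
  have := metric_triangle q b q'.
  by rewrite (metric_sym a') (metric_sym q' b); lra.
have D_B a b b' : mdist b b' <= D a b + D a b'.
  rewrite -lerBlDr; apply: (D_ge) => p q pq; rewrite lerBlDl -lerBlDr.
  apply: D_ge => p' q' pq'; have [_ dpq] := dis _ _ _ _ pq pq'.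
  have := metric_triangle b q b'; have := metric_triangle q q' b'.
  have := metric_triangle p a p'.
  by rewrite (metric_sym b q) (metric_sym p a); lra.
pose d (x y : set_type A + set_type B) : R := match x, y with
  | inl a, inl a' => mdist a a' | inr b, inr b' => mdist b b'
  | inl a, inr b => D (set_val a) (set_val b)
  | inr b, inl a => D (set_val a) (set_val b) end.
have dP : is_metric d.
  split.
  - by move=> [x|x]; rewrite /= mdistxx.
  - move=> [x|x] [y|y] /=.
    + by move=> /mdist_positivity ->.
    + by move=> xy; have := D_gt0 (set_val x) (set_val y); rewrite xy ltxx.
    + by move=> xy; have := D_gt0 (set_val y) (set_val x); rewrite xy ltxx.
    + by move=> /mdist_positivity ->.
  - by move=> [x|x] [y|y] //=; rewrite metric_sym.
  - move=> [y|y] [x|x] [z|z] /=; rewrite ?mdist_set_val.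
    + exact: metric_triangle.
    + exact: D_tril.
    + by rewrite addrC (metric_sym _ (set_val z)); exact: D_tril.
    + exact: D_B.
    + exact: D_A.
    + by rewrite (metric_sym _ (set_val z)); exact: D_trir.
    + by rewrite addrC; exact: D_trir.
    + exact: metric_triangle.
apply: (@le_trans _ _ (@hausdorff_dist R (metric_of dP) (range inl) (range inr))).
  by apply: ereal_inf_lbound; exists (metric_of dP), inl, inr; split.
have e4 : 0 < e / 4 by lra.
apply: hausdorff_dist_le.
  move=> _ [a _ <-]; have [p [q [Bq pq ap]]] := AS _ _ (set_valP a) e4.
  exists (inr (exist _ q (mem_set Bq))); first by eexists.
  suff : D (set_val a) q <= e by [].
  by have := D_le (set_val a) q _ _ pq; rewrite mdistxx; lra.
move=> _ [b _ <-]; have [p [q [Ap pq qb]]] := BS _ _ (set_valP b) e4.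
exists (inl (exist _ p (mem_set Ap))); first by eexists.
suff : D p (set_val b) <= e by [].
by have := D_le p (set_val b) _ _ pq; rewrite mdistxx; lra.
Qed.

Lemma orbit_hausdorff_lt A B (e : R) : (orbit_hausdorff A B < e%:E)%E ->
  exists2 I, Iso X I &
    (forall a, closed_val A a -> exists2 b, closed_val B b & mdist (I a) b < e) /\
    (forall b, closed_val B b -> exists2 a, closed_val A a & mdist (I a) b < e).
Proof.
move=> /ereal_inf_lt[_ [I II <-]] /hausdorff_dist_lt[AB BA].
exists I => //; split=> [a Aa|b /BA[_ [a Aa <-]]]; last by exists a.
by apply: AB; exists a.
Qed.

Lemma orbit_hausdorff_le A B (I : X -> X) (e : R) : Iso X I ->
  (forall a, closed_val A a -> exists2 b, closed_val B b & mdist (I a) b <= e) ->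
  (forall b, closed_val B b -> exists2 a, closed_val A a & mdist (I a) b <= e) ->
  (orbit_hausdorff A B <= e%:E)%E.
Proof.
move=> II AB BA; apply: (@le_trans _ _ (hausdorff_dist (I @` A) B)).
  by apply: ereal_inf_lbound; exists I.
apply: hausdorff_dist_le => [_ [a Aa <-]|b Bb]; first exact: AB.
by have [a Aa ab] := BA b Bb; exists (I a) => //; exists a.
Qed.

End gromov_hausdorff.

(** * Borel predicates and Borel maps into the space of closed sets *)

Section borel.
Context {X : topologicalType}.

Definition borel (P : X -> Prop) := <<s @open X >> [set x | P x].

Lemma borel_open (P : X -> Prop) : open [set x | P x] -> borel P.
Proof. by move=> oP; exact: sub_gen_smallest. Qed.

Lemma borel_ext (P Q : X -> Prop) : (forall x, P x <-> Q x) -> borel P -> borel Q.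
Proof. by move=> PQ; rewrite /borel (_ : mkset P = mkset Q)//; apply/funext => x; apply/propext. Qed.

Lemma borel_not (P : X -> Prop) : borel P -> borel (fun x => ~ P x).
Proof.
move=> bP; have [_ + _] := smallest_sigma_algebra [set: X] (@open X).
by move=> /(_ _ bP); rewrite setTD.
Qed.

Lemma borel_ex (T : countType) (P : T -> X -> Prop) :
  (forall t, borel (P t)) -> borel (fun x => exists t, P t x).
Proof.
move=> bP; have [b0 _ bU] := smallest_sigma_algebra [set: X] (@open X).
pose F n := if unpickle n is Some t then [set x | P t x] else set0.
have : <<s @open X >> (\bigcup_n F n).
  by apply: bU => n; rewrite /F; case: unpickle => // t; exact: bP.
rewrite (_ : \bigcup_n F n = [set x | exists t, P t x])//.
apply/seteqP; split=> x /=; rewrite /bigcup /=.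
  by move=> [n _]; rewrite /F; case: unpickle => // t Pt; exists t.
by move=> [t Pt]; exists (pickle t) => //; rewrite /F pickleK.
Qed.

Lemma borel_all (T : countType) (P : T -> X -> Prop) :
  (forall t, borel (P t)) -> borel (fun x => forall t, P t x).
Proof.
move=> bP; have : borel (fun x => ~ exists t, ~ P t x).
  by apply: borel_not; apply: borel_ex => t; exact: borel_not.
by apply: borel_ext => x; split=> [/forallNP H t|H [t]]; [apply: contrapT; exact: H|].
Qed.

Lemma borel_const (Q : Prop) : borel (fun _ : X => Q).
Proof.
have [q|q] := pselect Q.
  by apply: borel_ext (borel_open openT) => x.
by apply: borel_ext (borel_open open0) => x.
Qed.

Lemma borel_and (P Q : X -> Prop) :
  borel P -> borel Q -> borel (fun x => P x /\ Q x).
Proof.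
move=> bP bQ; have : borel (fun x => forall b : bool, if b then P x else Q x).
  by apply: borel_all => -[].
by apply: borel_ext => x; split=> [H|[? ?] []//]; split; [exact: (H true)|exact: (H false)].
Qed.

Lemma borel_or (P Q : X -> Prop) :
  borel P -> borel Q -> borel (fun x => P x \/ Q x).
Proof.
move=> bP bQ; have : borel (fun x => exists b : bool, if b then P x else Q x).
  by apply: borel_ex => -[].
by apply: borel_ext => x; split=> [[[] ?]|[?|?]]; [left|right|exists true|exists false].
Qed.

End borel.

Section wijsman.
Context {R : realType} {X : metricType R}.

Lemma dist_to_continuous (x : X) : continuous (@dist_to R X x).
Proof.
move=> F; have /cvg_sup/(_ x) H : nbhs F --> F by [].
apply: cvg_trans (@initial_continuous _ _ (@dist_to R X x) F).
exact: cvg_app H.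
Qed.

Lemma borel_dist_to_lt (x : X) (q : R) : borel (fun F => dist_to x F < q).
Proof.
apply: borel_open; apply: (@open_comp _ _ (dist_to x) [set r | r < q]).
  by move=> F _; exact: dist_to_continuous.
exact: open_lt.
Qed.

(** As [dist_to] is 1-Lipschitz in the point, finitely many rational bounds on distances to points
    of the dense sequence [u] form a countable base of the Wijsman topology; open sets are thus
    countable unions of sets with Borel preimage. *)
Lemma borel_mapP {Y : topologicalType} (u : nat -> X) (f : Y -> nonempty_closed X) :
  (forall v (e : R), 0 < e -> exists n, mdist (u n) v < e) ->
  (forall n (q : R), borel (fun y => dist_to (u n) (f y) < q)) ->
  borel_map f.
Proof.
move=> uD fb.
have fN (l : seq (nat * (rat * rat))) : borel (fun y => forall a, a \in l ->
    ratr a.2.1 < dist_to (u a.1) (f y) < ratr a.2.2).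
  apply: borel_all => a; have [al|al] := boolP (a \in l); last first.
    by apply: borel_ext (borel_const True) => y; split.
  (* The strict lower bound is a countable union of large ones, which are complements of the given
     Borel sets. *)
  have := borel_and (fb a.1 (ratr a.2.2)) (borel_ex (fun r : nat =>
    borel_not (fb a.1 (ratr a.2.1 + r.+1%:R^-1)))).
  apply: borel_ext => y; split=> [[fy [r /negP]] + _|/(_ isT)/andP[fy1 fy2]].
    by rewrite -leNgt fy andbT; apply: lt_le_trans; rewrite ltrDl invr_gt0 ltr0n.
  split=> //; have d0 : 0 < dist_to (u a.1) (f y) - ratr a.2.1 by rewrite subr_gt0.
  have [r rq] := small_inv d0.
  by exists r; apply/negP; rewrite -leNgt -lerBrDl ltW.
suff : <<s @open (nonempty_closed X) >> `<=` [set B | <<s @open Y >> (f @^-1` B)] by [].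
apply: smallest_sub => [|O oO].
  have [b0 bC bU] := smallest_sigma_algebra [set: Y] (@open Y).
  split=> [|A bA|A bA]; first exact: b0.
    exact: (bC (f @^-1` A)).
  exact: (bU (fun n => f @^-1` (A n))).
pose N (l : seq (nat * (rat * rat))) (F : nonempty_closed X) := forall a, a \in l ->
  ratr a.2.1 < dist_to (u a.1) F < ratr a.2.2.
have ON F : O F -> exists l, N l F /\ forall G, N l G -> O G.
  move=> OF; pose FF : set_system (nonempty_closed X) := [set P |
    exists l, N l F /\ forall G, N l G -> P G].
  have FFF : Filter FF.
    split=> [|P Q [l [lF lP]] [k [kF kQ]]|P Q PQ [l [lF lP]]].
    - by exists [::].
    - exists (l ++ k); split=> [a|G lkG].
        by rewrite mem_cat => /orP[/lF|/kF].
      split; [apply: lP|apply: kQ] => a al; apply: lkG; rewrite mem_cat al//.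
      by rewrite orbT.
    - by exists l; split=> // G /lP/PQ.
  suff : FF --> F by apply; exact: open_nbhs_nbhs.
  apply/cvg_sup => x P [_ [[V oV <-] VF] VP].
  have [e /= e0 eV] : nbhs_ball (dist_to x F) V by apply/nbhs_ballP; exact: open_nbhs_nbhs.
  have e4 : 0 < e / 4 by lra.
  have [n nx] := uD x _ e4.
  have [|p pP] := @rat_in_itvoo _ (dist_to (u n) F - e / 4) (dist_to (u n) F); first by lra.
  have [|q qP] := @rat_in_itvoo _ (dist_to (u n) F) (dist_to (u n) F + e / 4); first by lra.
  move: pP qP; rewrite !in_itv /= => pP qP.
  exists [:: (n, (p, q))]; split=> [a|G /(_ _ (mem_head _ _)) /= Gpq].
    by rewrite inE => /eqP -> /=; lra.
  apply/VP/eV; rewrite /ball /=; have := dist_to_near (u n) x F.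
  by have := dist_to_near (u n) x G; rewrite !ler_norml ltr_norml; lra.
have : borel (fun y => exists l, (forall G, N l G -> O G) /\ N l (f y)).
  by apply: borel_ex => l; apply: borel_and (borel_const _) (fN l).
apply: borel_ext => y; split=> [[l [lO lf]]|/ON[l [lf lO]]]; first exact: lO.
by exists l.
Qed.

End wijsman.

(** * Borel selection of dense sequences *)

Section selection.
Context {R : realType} {U : metricType R}.

Definition least (P : nat -> Prop) : nat :=
  if pselect (exists n, `[< P n >]) is left h then ex_minn h else 0.

Lemma leastP (P : nat -> Prop) : (exists n, P n) -> P (least P).
Proof.
move=> [n Pn]; rewrite /least; case: pselect => [h|[]]; last by exists n; apply/asboolP.
by case: ex_minnP => m /asboolP.
Qed.

(** The graph of [least], default value [0] included, written with connectives and countable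
    quantifiers so that its Borelness can be read off. *)
Lemma least_eq (P : nat -> Prop) m : least P = m <->
  (P m /\ forall j, (m <= j)%N \/ ~ P j) \/ (m = 0%N /\ forall j, ~ P j).
Proof.
rewrite /least; case: pselect => [h|N].
  case: ex_minnP => n /asboolP Pn nmin; split=> [<-|[[Pm mmin]|[_ /(_ n)//]]].
    left; split=> // j; have [Pj|] := pselect (P j); last by right.
    by left; apply: nmin; apply/asboolP.
  apply/eqP; rewrite eqn_leq nmin ?andbT; last exact/asboolP.
  by have [|] := mmin n.
split=> [<-|[[Pm _]|[-> //]]]; last by case: N; exists m; apply/asboolP.
by right; split=> // j Pj; apply: N; exists j; apply/asboolP.
Qed.

Lemma borel_least {X : topologicalType} (P : X -> nat -> Prop) m :
  (forall j, borel (P ^~ j)) -> borel (fun x => least (P x) = m).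
Proof.
move=> bP; apply: (borel_ext (fun x => iff_sym (least_eq (P x) m))).
apply: borel_or; apply: borel_and => //; last 1 first.
- by apply: borel_all => j; exact: borel_not.
- by apply: borel_all => j; apply: borel_or (borel_const _) (borel_not _).
- exact: borel_const.
Qed.

Definition halfpow (k : nat) : R := 2^-1 ^+ k.

Lemma halfpow_gt0 k : 0 < halfpow k.
Proof. by rewrite exprn_gt0// invr_gt0. Qed.

Lemma halfpowS k : halfpow k = halfpow k.+1 + halfpow k.+1.
Proof. by rewrite /halfpow exprS; lra. Qed.

Lemma halfpow_le k j : halfpow (k + j) <= halfpow k.
Proof.
rewrite /halfpow exprD ler_piMr ?exprn_ge0 ?invr_ge0// exprn_ile1 ?invr_ge0//; lra.
Qed.

Lemma halfpow_small (e : R) : 0 < e -> exists k, halfpow k < e.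
Proof.
move=> /small_inv[k ke]; exists k.+1; apply: le_lt_trans ke.
rewrite /halfpow exprVn lef_pV2 ?posrE ?exprn_gt0 ?ltr0n//.
by rewrite -natrX ler_nat ltnW// ltn_expl.
Qed.

Hypothesis cU : complete_space U.
Variable u : nat -> U.
Hypothesis uD : forall v (e : R), 0 < e -> exists n, mdist (u n) v < e.

Let near (A : nonempty_closed U) k m := dist_to (u m) A < halfpow k.

(** An index [(m, k)] asks for a point of [A] near [u m] at precision [halfpow k]. The disjunction
    forces the start at [m] whenever [u m] is that near to [A]; otherwise any near point will do.
    Each step doubles the precision. *)
Fixpoint approx (i : nat * nat) (j : nat) (A : nonempty_closed U) : nat :=
  if j is j'.+1 then least (fun m =>
    mdist (u (approx i j' A)) (u m) < halfpow (i.2 + j') /\ near A (i.2 + j'.+1) m)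
  else least (fun m => near A i.2 m /\ (~ near A i.2 i.1 \/ m = i.1)).

Let near_ex A k : exists m, near A k m.
Proof.
have [a Aa] := closed_val_neq0 A; have [m mP] := uD a (halfpow_gt0 k).
by exists m; apply/dist_to_lt; exists a.
Qed.

Let near_next A k m : near A k m ->
  exists m', mdist (u m) (u m') < halfpow k /\ near A k.+1 m'.
Proof.
move=> /dist_to_lt[a Aa ma].
have e0 : 0 < Num.min (halfpow k.+1) (halfpow k - mdist (u m) a).
  by rewrite lt_min halfpow_gt0 subr_gt0.
have [m' m'P] := uD a e0; move: m'P; rewrite lt_min => /andP[m1 m2]; exists m'.
split; last by apply/dist_to_lt; exists a.
have := metric_triangle (u m) a (u m').
by rewrite (metric_sym a); move: m2; lra.
Qed.

Let approx_near i j A : near A (i.2 + j) (approx i j A).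
Proof.
elim: j => [|j /near_next] /=; last by rewrite -addnS => /leastP[].
suff /leastP[] : exists m, near A i.2 m /\ (~ near A i.2 i.1 \/ m = i.1).
  by rewrite addn0.
have [ni|ni] := pselect (near A i.2 i.1); first by exists i.1; split; [|right].
by have [m nm] := near_ex A i.2; exists m; split; [|left].
Qed.

Let approx_step i j A :
  mdist (u (approx i j A)) (u (approx i j.+1 A)) < halfpow (i.2 + j).
Proof. by have /near_next := approx_near i j A; rewrite -addnS => /leastP[]. Qed.

Let approx_dist i j l A :
  mdist (u (approx i j A)) (u (approx i (j + l) A)) <= 2 * halfpow (i.2 + j).
Proof.
(* The bound is strengthened by the geometric tail still to come, which makes the induction on [l]
   close. *)
suff : mdist (u (approx i j A)) (u (approx i (j + l) A)) <=
    2 * halfpow (i.2 + j) - 2 * halfpow (i.2 + (j + l)).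
  by have := halfpow_gt0 (i.2 + (j + l)); lra.
elim: l => [|l IH]; first by rewrite addn0 mdistxx subrr.
have := metric_triangle (u (approx i j A)) (u (approx i (j + l) A)) (u (approx i (j + l.+1) A)).
have := approx_step i (j + l) A; have := halfpowS (i.2 + (j + l)).
by rewrite !addnS; lra.
Qed.

Let approx_cvg i A : exists a, forall j, mdist (u (approx i j A)) a <= 2 * halfpow (i.2 + j).
Proof.
have [e e0|a aP] := @cauchy_limit _ _ cU (fun j => u (approx i j A)).
  have [|N NP] := @halfpow_small (e / 4); first by lra.
  exists N => m n Nm Nn.
  have := approx_dist i N (m - N) A; have := approx_dist i N (n - N) A.
  have := metric_triangle (u (approx i m A)) (u (approx i N A)) (u (approx i n A)).
  have := halfpow_le N i.2; rewrite !subnKC// (addnC N) (metric_sym (u (approx i m A)) (u (approx i N A))).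
  lra.
exists a => j; apply/ler_addgt0Pr => e e0; have [N NP] := aP e e0.
have := NP (j + N)%N (leq_addl _ _); have := approx_dist i j N A.
have := metric_triangle (u (approx i j A)) (u (approx i (j + N) A)) a; lra.
Qed.

Lemma borel_dense_selection : exists alpha : nat -> nonempty_closed U -> U,
  [/\ forall i A, closed_val A (alpha i A),
      forall A a (e : R) N, closed_val A a -> 0 < e ->
        exists2 i, (N <= i)%N & mdist (alpha i A) a < e &
      forall i j q, borel (fun A => mdist (alpha i A) (alpha j A) < q)].
Proof.
have /choice[lim limP] (iA : (nat * nat) * nonempty_closed U) : exists a,
  forall j, mdist (u (approx iA.1 j iA.2)) a <= 2 * halfpow (iA.1.2 + j) by exact: approx_cvg.
(* The first component of the decoded number is dropped, so each index [(m, k)] is used infinitely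
   often. *)
pose dec n : nat * nat := odflt (0, 0) (omap snd (unpickle n : option (nat * (nat * nat)))).
exists (fun n A => lim (dec n, A)); split.
- move=> n A; apply: closed_dist; first exact: closed_valP.
  move=> e e0; have [|j jP] := @halfpow_small (e / 4); first by lra.
  have := limP (dec n, A) j; have /dist_to_lt[a Aa ja] := approx_near (dec n) j A.
  have := halfpow_le j (dec n).2; rewrite (addnC j) => h1 h2; exists a => //.
  have := metric_triangle (lim (dec n, A)) (u (approx (dec n) j A)) a.
  by rewrite (metric_sym (lim _) (u _)); move: h1 h2 ja jP => /=; lra.
- move=> A a e N Aa e0; have [|k kP] := @halfpow_small (e / 4); first by lra.
  have [m ma] := uD a (halfpow_gt0 k).
  have [l lN] := pickle_unbounded (m, k) N; exists (pickle (l, (m, k))) => //.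
  rewrite /dec pickleK /=; have := limP ((m, k), A) 0%N; rewrite /= addn0.
  have nm : near A k m by apply/dist_to_lt; exists a.
  have -> : least (fun m0 => near A k m0 /\ (~ near A k m \/ m0 = m)) = m.
    apply/least_eq; left; split; first by split; [|right].
    move=> j; have [->|jm] := eqVneq j m; first by left.
    by right=> -[_ [//|/eqP]]; apply/negP.
  have := metric_triangle (lim ((m, k), A)) (u m) a.
  by rewrite (metric_sym (u m) (lim _)); lra.
have bapprox i j m : borel (fun A => approx i j A = m).
  elim: j m => [|j IH] m /=.
    apply: borel_least => n; apply: borel_and; first exact: borel_dist_to_lt.
    apply: borel_or (borel_const _); apply: borel_not; exact: borel_dist_to_lt.
  have : borel (fun A => exists m0, approx i j A = m0 /\
      least (fun m => mdist (u m0) (u m) < halfpow (i.2 + j) /\ near A (i.2 + j.+1) m) = m).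
    apply: borel_ex => m0; apply: borel_and => //; apply: borel_least => n.
    by apply: borel_and (borel_const _) _; exact: borel_dist_to_lt.
  by apply: borel_ext => A; split=> [[_ [<-]]|<-] //; exists (approx i j A).
move=> n n' q; set i := dec n; set i' := dec n'.
(* Each limit is within [2 * halfpow j] of its [j]-th approximation, so a strict inequality between
   limits is certified, with margin [4 * halfpow j], at some finite stage. *)
have : borel (fun A => exists jm : nat * (nat * nat),
    (approx i jm.1 A = jm.2.1 /\ approx i' jm.1 A = jm.2.2) /\
    mdist (u jm.2.1) (u jm.2.2) + 4 * halfpow jm.1 < q).
  apply: borel_ex => jm; apply: borel_and (borel_const _).
  by apply: borel_and; exact: bapprox.
apply: borel_ext => A; split.
  move=> [[j [m m']] /= [[<- <-]]].
  have := limP (i, A) j; have := limP (i', A) j; rewrite /=.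
  have := halfpow_le j i.2; have := halfpow_le j i'.2; rewrite !(addnC j).
  have := metric_triangle (lim (i, A)) (u (approx i j A)) (lim (i', A)).
  have := metric_triangle (u (approx i j A)) (u (approx i' j A)) (lim (i', A)).
  by rewrite (metric_sym (lim (i, A)) (u _)); lra.
move=> dq; have [|j jP] := @halfpow_small ((q - mdist (lim (i, A)) (lim (i', A))) / 8).
  by rewrite divr_gt0// subr_gt0.
exists (j, (approx i j A, approx i' j A)); split=> //=.
have := limP (i, A) j; have := limP (i', A) j; rewrite /=.
have := halfpow_le j i.2; have := halfpow_le j i'.2; rewrite !(addnC j).
have := metric_triangle (u (approx i j A)) (lim (i, A)) (u (approx i' j A)).
have := metric_triangle (lim (i, A)) (lim (i', A)) (u (approx i' j A)).
by rewrite (metric_sym (lim (i', A)) (u _)); move: jP; lra.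
Qed.

End selection.

(** * Coding distance matrices *)

Definition dist_code : countType := (nat + nat * nat * rat)%type.

(* [inl i] stands for the [i]-th point of a space; the leaf [inr (i, j, q)] is
   singled out by its distances to [inl i] and [inl j] and records the number [q]. *)
Definition code_dist (s t : dist_code) : rat :=
  match s, t with
  | inl i, inl j => (i != j)%:R
  | inl k, inr (ij, q) | inr (ij, q), inl k =>
      10 + `|q| + (~~ ((k == ij.1) || (k == ij.2)))%:R
  | inr (ij, q), inr (kl, r) => `| `|q| - `|r| | + 5 * (ij != kl)%:R
  end.

Lemma neq_triangle (T : eqType) (y x z : T) :
  (x != z)%:R <= (x != y)%:R + (y != z)%:R :> rat.
Proof.
have [->|] := eqVneq x y; first by rewrite add0r.
by move=> _; case: (x != z); case: (y != z).
Qed.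

(** Only a pseudometric, as the leaves for [q] and [- q] are at distance 0; the absolute values keep
    every leaf at distance at least [10] from the codes [inl k]. *)
Lemma code_dist_pseudometric : is_pseudometric code_dist.
Proof.
have b01 (b : bool) : (0 <= b%:R :> rat) && (b%:R <= 1 :> rat) by case: b.
have b1 : (~~ false)%:R = 1 :> rat by [].
split.
- by move=> [i|[ij q]] /=; rewrite eqxx ?subrr ?normr0 ?mulr0 ?addr0.
- by move=> [i|[ij q]] [k|[kl r]] //=; rewrite eq_sym// distrC.
move=> [j|[y r]] [i|[x q]] [k|[z p]] /=.
- exact: neq_triangle.
- have [<-|_] := eqVneq i j; first by rewrite add0r.
  by rewrite b1; have := b01 (~~ ((i == z.1) || (i == z.2))); have := b01 (~~ ((j == z.1) || (j == z.2))); lra.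
- have [<-|_] := eqVneq j k; first by rewrite addr0.
  by rewrite b1; have := b01 (~~ ((k == x.1) || (k == x.2))); have := b01 (~~ ((j == x.1) || (j == x.2))); lra.
- have := b01 (x != z); have := b01 (~~ ((j == x.1) || (j == x.2))).
  have := b01 (~~ ((j == z.1) || (j == z.2))); have := normr_ge0 q; have := normr_ge0 p.
  have : `| `|q| - `|p| | <= `|q| + `|p| by rewrite ler_norml; have := normr_ge0 q; have := normr_ge0 p; lra.
  lra.
- have := b01 (i != k); have := b01 (~~ ((i == y.1) || (i == y.2))).
  by have := b01 (~~ ((k == y.1) || (k == y.2))); have := normr_ge0 r; lra.
- have := ler_norm (`|p| - `|r|); rewrite (distrC `|p|).
  have [->|_] := eqVneq y z; first by rewrite mulr0; lra.
  by rewrite b1; have := b01 (~~ ((i == y.1) || (i == y.2))); have := b01 (~~ ((i == z.1) || (i == z.2))); lra.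
- have := ler_norm (`|q| - `|r|).
  have [->|_] := eqVneq x y; first by rewrite mulr0; lra.
  by rewrite b1; have := b01 (~~ ((k == y.1) || (k == y.2))); have := b01 (~~ ((k == x.1) || (k == x.2))); lra.
- have := neq_triangle y x z; have := ler_distD `|r| `|q| `|p|; lra.
Qed.

Definition code_map (s : nat -> nat) (t : dist_code) : dist_code :=
  match t with inl i => inl (s i) | inr (i, j, q) => inr (s i, s j, q) end.

Lemma code_mapK (s s' : nat -> nat) :
  cancel s s' -> cancel (code_map s) (code_map s').
Proof. by move=> sK [i|[[i j] q]] /=; rewrite !sK. Qed.

Lemma code_map_isometric (s : nat -> nat) : injective s ->
  forall x y, code_dist (code_map s x) (code_map s y) = code_dist x y.
Proof.
by move=> si [i|[[i j] q]] [k|[[k l] r]] /=; rewrite ?xpair_eqE !(inj_eq si).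
Qed.

Section active.
Context {R : realType}.

(* The codes describing a space whose [i]-th and [j]-th points are at distance
   [r i j]; an interval of rationals is used so that [r i j] may be irrational. *)
Definition active (r : nat -> nat -> R) (t : dist_code) : Prop :=
  if t is inr (i, j, q) then r i j < ratr q < r i j + 1 / 4 else True.

Let dist (s t : dist_code) : R := ratr (code_dist s t).

Let distl i j : dist (inl i) (inl j) = (i != j)%:R.
Proof. by rewrite /dist /= ratr_nat. Qed.

Let distlr k ij q : dist (inl k) (inr (ij, q)) =
  10 + `|ratr q| + (~~ ((k == ij.1) || (k == ij.2)))%:R.
Proof. by rewrite /dist /= (rmorphD _ (10 + _)) (rmorphD _ 10) /= ratr_norm !ratr_nat. Qed.

Let distr ij kl q r : dist (inr (ij, q)) (inr (kl, r)) =
  `| `|ratr q| - `|ratr r| | + 5 * (ij != kl)%:R.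
Proof. by rewrite /dist /= rmorphD rmorphM /= !ratr_nat ratr_norm rmorphB /= !ratr_norm. Qed.

(** The windows of length [1 / 4] above [r] and [r'] are translates by less than [c], so the window
    above [r'] meets the [c]-neighbourhood of [q] in an open interval, where a rational is
    picked. *)
Lemma active_shift (r r' c : R) (q : rat) : 0 <= r -> 0 <= r' -> `|r - r'| < c ->
  r < ratr q < r + 1 / 4 ->
  exists2 q' : rat, r' < ratr q' < r' + 1 / 4 & `| `|ratr q| - `|ratr q'| | < c.
Proof.
move=> r0 r0'; rewrite ltr_norml => rr' qr.
have [|q'] := @rat_in_itvoo _ (Num.max r' (ratr q - c)) (Num.min (r' + 1 / 4) (ratr q + c)).
  by rewrite lt_min !gt_max; apply/andP; split; apply/andP; split; lra.
rewrite in_itv /= lt_min gt_max => /andP[/andP[q1 q2] /andP[q3 q4]].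
exists q'; first by rewrite q1 q3.
have q0 : 0 < ratr q :> R by lra.
have q'0 : 0 < ratr q' :> R by lra.
by rewrite (gtr0_norm q0) (gtr0_norm q'0) ltr_norml; lra.
Qed.

(* The codes [inl i] are recognized by the presence of a code at distance 1:
   distances between a leaf and any other active code avoid a neighbourhood of 1. *)
Lemma code_matching (r r' : nat -> nat -> R) (M : dist_code -> dist_code -> Prop) (e : R) :
  0 < e -> e <= 1 / 50 -> (forall i j, 0 <= r i j) -> (forall i j, 0 <= r' i j) ->
  (forall i j, r' i j = r' j i) ->
  (forall t, active r t -> exists t', M t t') ->
  (forall t', active r' t' -> exists t, M t t') ->
  (forall t t', M t t' -> active r t /\ active r' t') ->
  (forall t t' s s', M t t' -> M s s' -> `|dist t s - dist t' s'| < e) ->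
  exists2 s : nat -> nat, (forall i j, M (inl i) (inl j) <-> j = s i) /\
      (forall j, exists i, j = s i) &
    forall i j, r' (s i) (s j) <= r i j + e.
Proof.
move=> e0 e50 r0 r0' r'C Ml Mr Mact Mdis.
have act_dist (f : nat -> nat -> R) ij q t : (forall i j, 0 <= f i j) ->
    active f (inr (ij, q)) -> active f t ->
    dist t (inr (ij, q)) < 1 / 2 \/ 2 < dist t (inr (ij, q)).
  move=> f0; case: ij => i j; case: t => [k|[[k l] p]] /= qf pf.
    right; rewrite distlr; have := normr_ge0 (ratr q : R).
    by case: (~~ _) => /=; lra.
  rewrite distr; have [e'|_] := eqVneq (k, l) (i, j); last first.
    by right; have := normr_ge0 (`|ratr p : R| - `|ratr q|); rewrite /=; lra.
  left; move: e' pf => [-> ->] pf; have fij := f0 i j.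
  have q0 : 0 < ratr q :> R by lra.
  have p0 : 0 < ratr p :> R by lra.
  by rewrite (gtr0_norm q0) (gtr0_norm p0) mulr0 addr0 ltr_norml; lra.
have Mlr i t' : M (inl i) t' -> exists j, t' = inl j.
  move=> M1; have [s' M2] := Ml (inl i.+1) I; have := Mdis _ _ _ _ M1 M2.
  have [_ a1] := Mact _ _ M1; have [_ a2] := Mact _ _ M2.
  have sym : dist t' s' = dist s' t' by rewrite /dist (is_pseudometric_sym code_dist_pseudometric).
  rewrite distl (_ : i != i.+1) ?ltr_norml; last by rewrite neq_ltn leqnn.
  case: t' a1 sym {M1} => [j _ _|[kl q] a1 sym]; first by exists j.
  by rewrite sym; have := act_dist _ _ _ _ r0' a1 a2; rewrite /=; lra.
have Mrl t j : M t (inl j) -> exists i, t = inl i.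
  move=> M1; have [s M2] := Mr (inl j.+1) I; have := Mdis _ _ _ _ M1 M2.
  have [a1 _] := Mact _ _ M1; have [a2 _] := Mact _ _ M2.
  have sym : dist t s = dist s t by rewrite /dist (is_pseudometric_sym code_dist_pseudometric).
  rewrite distl (_ : j != j.+1) ?ltr_norml; last by rewrite neq_ltn leqnn.
  case: t a1 sym {M1} => [i _ _|[kl q] a1 sym]; first by exists i.
  by rewrite sym; have := act_dist _ _ _ _ r0 a1 a2; rewrite /=; lra.
have /choice[s sP] i : exists j, M (inl i) (inl j).
  by have [t' M1] := Ml (inl i) I; have [j e'] := Mlr _ _ M1; exists j; rewrite -e'.
have Muniq i j i' j' : M (inl i) (inl j) -> M (inl i') (inl j') -> (i == i') = (j == j').
  move=> M1 M2; have := Mdis _ _ _ _ M1 M2; rewrite !distl.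
  by case: eqP; case: eqP => //= _ _; rewrite ltr_norml; lra.
have sE i j : M (inl i) (inl j) <-> j = s i.
  by split=> [M1|->//]; apply/eqP; rewrite -(Muniq _ _ _ _ M1 (sP i)).
have sS j : exists i, j = s i.
  have [t M1] := Mr (inl j) I; have [i e'] := Mrl _ _ M1.
  by exists i; apply/sE; rewrite -e'.
exists s => // i j; apply/ler_addgt0Pr => d d0.
have [|q] := @rat_in_itvoo _ (r i j) (r i j + Num.min d (1 / 4)).
  by rewrite ltrDl lt_min; lra.
rewrite in_itv /= -ltrBlDl lt_min => /andP[q1 /andP[q2 q3]].
have [|t' M1] := Ml (inr (i, j, q)); first by rewrite /=; lra.
case: t' M1 => [k M1|[[k l] q'] M1]; first by have [] := Mrl _ _ M1.
have [_ /= q'P] := Mact _ _ M1.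
have D n : `|dist (inl n) (inr (i, j, q)) - dist (inl (s n)) (inr (k, l, q'))| < e.
  exact: Mdis _ _ _ _ (sP n) M1.
have [k0 kE] := sS k; have [l0 lE] := sS l.
have s_eq m n : (s m == s n) = (m == n) by rewrite (Muniq _ _ _ _ (sP m) (sP n)).
have {}D n : `|(10 + `|ratr q| + (~~ ((n == i) || (n == j)))%:R : R) -
     (10 + `|ratr q'| + (~~ ((n == k0) || (n == l0)))%:R)| < e.
  by have := D n; rewrite !distlr /= kE lE !s_eq.
have qq' : `|ratr q| - `|ratr q'| < e /\ `|ratr q'| - `|ratr q| < e :> R.
  (* An index different from all four makes both indicator terms equal to 1, which isolates the
     recorded numbers. *)
  have := D (i + j + k0 + l0).+1.
  do 4!(rewrite (_ : (_ == _) = false); last by apply/negP => /eqP; lia).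
  by rewrite ltr_norml /=; lra.
have in_eq n : ((n == i) || (n == j)) = ((n == k0) || (n == l0)).
  have := D n; case: ((n == i) || (n == j)); case: ((n == k0) || (n == l0)) => //=;
  by rewrite ltr_norml; lra.
(* By [in_eq] the unordered pairs of indices agree; the order is settled by the symmetry of [r']. *)
have -> : r' (s i) (s j) = r' k l.
  have i_in : (i == k0) || (i == l0) by rewrite -in_eq eqxx.
  have j_in : (j == k0) || (j == l0) by rewrite -in_eq eqxx orbT.
  have k_in : (k0 == i) || (k0 == j) by rewrite in_eq eqxx.
  have l_in : (l0 == i) || (l0 == j) by rewrite in_eq eqxx orbT.
  rewrite kE lE; case/orP: i_in => /eqP ei.
    case/orP: l_in => /eqP el; last by rewrite el ei.
    by rewrite (_ : j = l0) ?ei//; case/orP: j_in => /eqP ->; rewrite ?el ?ei.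
  case/orP: k_in => /eqP ek; last by rewrite ek ei r'C.
  by rewrite (_ : j = k0) ?ei 1?r'C//; case/orP: j_in => /eqP ->; rewrite ?ek ?ei.
have rij := r0 i j; have rkl := r0' k l.
have q_gt0 : 0 < ratr q :> R by lra.
have q'_gt0 : 0 < ratr q' :> R by lra.
by move: qq'; rewrite (gtr0_norm q_gt0) (gtr0_norm q'_gt0); lra.
Qed.

End active.

(** * Reduction of the Gromov-Hausdorff distance *)

Lemma closure_neq0 {T : topologicalType} (S : set T) : S !=set0 -> closure S !=set0.
Proof. by move=> [x Sx]; exists x; exact: subset_closure. Qed.

Definition closure_of {R : realType} {U : metricType R}
    (S : set U) (S0 : S !=set0) : nonempty_closed U :=
  NonemptyClosed (@closed_closure U S) (closure_neq0 S0).

Lemma dist_to_closure {R : realType} {U : metricType R} (S : set U) (S0 : S !=set0)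
    x (e : R) :
  dist_to x (closure_of S0) < e <-> exists2 a, S a & mdist x a < e.
Proof.
split=> [/dist_to_lt[a /closure_dist Sa xa]|[a Sa xa]]; last first.
  by apply/dist_to_lt; exists a => //; exact: subset_closure.
have [|b Sb ab] := Sa (e - mdist x a); first by rewrite subr_gt0.
by exists b => //; have := metric_triangle x a b; lra.
Qed.

Section GH_to_orbit.
Context {R : realType} {U : metricType R}.
Hypothesis cU : complete_space U.
Variables (z : nat -> U) (idx : dist_code -> nat).
Hypothesis zF : katetov_frame code_dist z idx.
Variable alpha : nat -> nonempty_closed U -> U.
Hypothesis alphaA : forall i A, closed_val A (alpha i A).
Hypothesis alphaD : forall A a (e : R) N, closed_val A a -> 0 < e ->
  exists2 i, (N <= i)%N & mdist (alpha i A) a < e.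
Hypothesis alphaB : forall i j q, borel (fun A => mdist (alpha i A) (alpha j A) < q).

Let dist A i j : R := mdist (alpha i A) (alpha j A).
Let p t := z (idx t).
Let pE s t : mdist (p s) (p t) = ratr (code_dist s t).
Proof. exact: frame_isometric zF s t. Qed.

Let S A := [set p t | t in active (dist A)].
Let S0 A : S A !=set0.
Proof. by exists (p (inl 0%N)); exists (inl 0%N). Qed.

Definition code_set A := closure_of (S0 A).

Let code_set_in A t : active (dist A) t -> closed_val (code_set A) (p t).
Proof. by move=> At; apply: subset_closure; exists t. Qed.

Let code_set_near A a (e : R) : closed_val (code_set A) a -> 0 < e ->
  exists2 t, active (dist A) t & mdist a (p t) < e.
Proof. by move=> /closure_dist H /H[_ [t At <-]]; exists t. Qed.

Lemma borel_code_set : borel_map code_set.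
Proof.
apply: (borel_mapP (frame_dense zF)) => n q.
have le i j c : borel (fun A => dist A i j <= c).
  have : borel (fun A => forall n, dist A i j < c + n.+1%:R^-1).
    by apply: borel_all => k; exact: alphaB.
  apply: borel_ext => A; split=> [H|H k]; last first.
    by apply: le_lt_trans H _; rewrite ltrDl invr_gt0 ltr0n.
  apply/ler_addgt0Pr => e /small_inv[k ke]; apply: ltW; apply: lt_le_trans (H k) _.
  by rewrite lerD2l ltW.
have bact t : borel (fun A => active (dist A) t).
  case: t => [i|[[i j] r]] /=; first exact: borel_const.
  have : borel (fun A => dist A i j < ratr r /\ ~ dist A i j <= ratr r - 1 / 4).
    by apply: borel_and; [exact: alphaB|exact: borel_not].
  apply: borel_ext => A; split=> [[H1 /negP H2]|/andP[H1 H2]].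
    by move: H2; rewrite -ltNge; lra.
  by split=> //; apply/negP; rewrite -ltNge; lra.
have : borel (fun A => exists t, active (dist A) t /\ mdist (z n) (p t) < q).
  by apply: borel_ex => t; apply: borel_and => //; exact: borel_const.
apply: borel_ext => A; split.
  by move=> [t [At nt]]; apply/dist_to_closure; exists (p t) => //; exists t.
by move=> /dist_to_closure[_ [t At <-] nt]; exists t.
Qed.

(** Back and forth along the correspondence gives a permutation [s] of the indices that almost
    preserves the distance matrices; the isometry of the codes induced by [s] extends to [U]. *)
Lemma orbit_of_GH (e : R) : 0 < e -> exists2 d : R, 0 < d &
  forall A B, (GH A B < d%:E)%E -> (orbit_hausdorff (code_set A) (code_set B) < e%:E)%E.
Proof.
move=> e0; pose d := e / 20; exists d; first by rewrite /d; lra.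
have d0 : 0 < d by rewrite /d; lra.
move=> A B /GH_correspondence[C [CA CB Cdis]].
pose Q m n := exists a b, [/\ C a b, mdist (alpha m A) a < d & mdist (alpha n B) b < d].
(* The correspondence contributes [2 * d], the four approximations [d] each. *)
have Qdis m n m' n' : Q m n -> Q m' n' -> `|dist A m m' - dist B n n'| < 6 * d.
  move=> [a [b [ab ma nb]]] [a' [b' [ab' ma' nb']]].
  have := Cdis _ _ _ _ ab ab'; rewrite !ltr_norml /dist.
  have := metric_triangle (alpha m A) a (alpha m' A).
  have := metric_triangle a a' (alpha m' A).
  have := metric_triangle a (alpha m A) a'.
  have := metric_triangle (alpha m A) (alpha m' A) a'.
  have := metric_triangle (alpha n B) b (alpha n' B).
  have := metric_triangle b b' (alpha n' B).
  have := metric_triangle b (alpha n B) b'.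
  have := metric_triangle (alpha n B) (alpha n' B) b'.
  rewrite (metric_sym a (alpha m A)) (metric_sym b (alpha n B)).
  by rewrite (metric_sym a' (alpha m' A)) (metric_sym b' (alpha n' B)); lra.
(* Compatibility of pairs says that they belong to the graph of an injection. *)
pose K (a b : nat * nat) := (a.1 == b.1) = (a.2 == b.2).
have fresh (l : seq nat) : exists N, forall n, (N <= n)%N -> n \notin l.
  exists (\max_(i <- l) i.+1) => n ln; apply/negP => nl.
  have : (n.+1 <= \max_(i <- l) i.+1)%N by exact: (@leq_bigmax_seq _ l xpredT succn n nl isT).
  lia.
have [|a b|l [lQ lK] m|l [lQ lK] n|x [y [xyQ xyK xS yS]]] := @back_and_forth Q K.
- by move=> a; rewrite /K !eqxx.
- by rewrite /K (eq_sym b.1) (eq_sym b.2).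
- have [/mapP[[m' n] al /= ->]|ml] := boolP (m \in map fst l).
    by exists n; split; [exact: (lQ _ al)|move=> b bl; exact: lK].
  (* Each point of [B] is approximated at arbitrarily large indices, so a partner not yet used is
     available. *)
  have [N NP] := fresh (map snd l); have [b Bb mb] := CA _ (alphaA m A).
  have [n Nn nb] := alphaD N Bb d0; exists n; split.
    by exists (alpha m A), b; rewrite mdistxx.
  move=> c cl; rewrite /K /=; transitivity false.
    by apply/negP => /eqP e1; move/negP: ml; apply; rewrite -e1 map_f.
  apply/esym/negP => /eqP e1; move/negP: (NP _ Nn); apply; rewrite -e1 map_f//.
- have [/mapP[[m n'] al /= ->]|nl] := boolP (n \in map snd l).
    by exists m; split; [exact: (lQ _ al)|move=> b bl; exact: lK].
  have [N NP] := fresh (map fst l); have [a Aa an] := CB _ (alphaA n B).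
  have [m Nm ma] := alphaD N Aa d0; exists m; split.
    by exists a, (alpha n B); rewrite mdistxx.
  move=> c cl; rewrite /K /=; transitivity false.
    by apply/negP => /eqP e1; move/negP: (NP _ Nm); apply; rewrite -e1 map_f.
  by apply/esym/negP => /eqP e1; move/negP: nl; apply; rewrite -e1 map_f.
have /choice[f fP] := xS; have /choice[g gP] := yS.
pose s m := y (f m); pose s' n := x (g n).
have xy i j : x i = x j <-> y i = y j.
  by have := xyK i j; rewrite /K /= => E; split=> /eqP; [rewrite E|rewrite -E] => /eqP.
have sK : cancel s s'.
  by move=> m; rewrite /s /s' -[RHS]fP; apply/xy; rewrite gP.
have s'K : cancel s' s.
  by move=> n; rewrite /s /s' -[RHS]gP; apply/xy; rewrite fP.
have sQ m : Q m (s m) by rewrite -{1}(fP m); exact: xyQ.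
have [I II Ip] := frame_isometry cU zF (code_mapK sK) (code_mapK s'K)
  (code_map_isometric (can_inj sK)).
have sdist i j : `|dist A i j - dist B (s i) (s j)| < 6 * d by exact: Qdis.
have dist0 D i j : 0 <= dist D i j by exact: mdist_ge0.
suff H : (orbit_hausdorff (code_set A) (code_set B) <= (e / 2)%:E)%E.
  by apply: le_lt_trans H _; rewrite lte_fin; lra.
apply: (orbit_hausdorff_le II) => [a|b] /code_set_near/(_ d0)[t At at'].
  suff [t' Bt' tt'] : exists2 t', active (dist B) t' & mdist (I (p t)) (p t') < 6 * d.
    exists (p t'); first exact: code_set_in.
    have := metric_triangle (I a) (I (p t)) (p t'); rewrite II.1.
    by move: at' tt'; rewrite /d; lra.
  rewrite Ip; case: t At {at'} => [i|[[i j] q]] /= At.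
    by exists (inl (s i)) => //; rewrite mdistxx; lra.
  have [q' q'P qq'] := active_shift (dist0 A i j) (dist0 B (s i) (s j)) (sdist i j) At.
  exists (inr (s i, s j, q')) => //; rewrite pE /= eqxx mulr0 addr0 ratr_norm rmorphB /=.
  by rewrite !ratr_norm.
suff [t' At' tt'] : exists2 t', active (dist A) t' & mdist (I (p t')) (p t) < 6 * d.
  exists (p t'); first exact: code_set_in.
  have := metric_triangle (I (p t')) (p t) b; rewrite (metric_sym (p t) b).
  by move: at' tt'; rewrite /d; lra.
case: t At {at'} => [i|[[i j] q]] /= At.
  by exists (inl (s' i)) => //; rewrite Ip /= s'K mdistxx; lra.
have BA : `|dist B i j - dist A (s' i) (s' j)| < 6 * d.
  by rewrite distrC; have := sdist (s' i) (s' j); rewrite !s'K.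
have [q' q'P qq'] := active_shift (dist0 B i j) (dist0 A (s' i) (s' j)) BA At.
exists (inr (s' i, s' j, q')) => //; rewrite Ip metric_sym /= !s'K pE /= eqxx mulr0 addr0.
by rewrite ratr_norm rmorphB /= !ratr_norm.
Qed.

Lemma GH_of_orbit (e : R) : 0 < e -> exists2 d : R, 0 < d &
  forall A B, (orbit_hausdorff (code_set A) (code_set B) < d%:E)%E -> (GH A B < e%:E)%E.
Proof.
(* The bound [1 / 100] makes the distortion [2 * d] of the matching at most the [1 / 50] required by
   [code_matching]. *)
move=> e0; pose d := Num.min (e / 8) (1 / 100).
have d0 : 0 < d by rewrite lt_min; lra.
have de : d <= e / 8 by rewrite /d ge_min lexx.
have d1 : d <= 1 / 100 by rewrite /d ge_min lexx orbT.
exists d => // A B /orbit_hausdorff_lt[I [Ii _] [AB BA]].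
pose M t t' := [/\ active (dist A) t, active (dist B) t' & mdist (I (p t)) (p t') < d].
have Ml t : active (dist A) t -> exists t', M t t'.
  move=> At; have [b Bb tb] := AB _ (code_set_in At).
  have [|t' Bt' bt'] := code_set_near Bb (_ : 0 < d - mdist (I (p t)) b).
    by rewrite subr_gt0.
  by exists t'; split=> //; have := metric_triangle (I (p t)) b (p t'); lra.
have Mr t' : active (dist B) t' -> exists t, M t t'.
  move=> Bt'; have [a Aa at'] := BA _ (code_set_in Bt').
  have [|t At a_t] := code_set_near Aa (_ : 0 < d - mdist (I a) (p t')).
    by rewrite subr_gt0.
  exists t; split=> //; have := metric_triangle (I (p t)) (I a) (p t').
  by rewrite Ii (metric_sym (p t)); lra.
have Mact t t' : M t t' -> active (dist A) t /\ active (dist B) t' by case.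
have Mdis t t' s s' : M t t' -> M s s' ->
    `|ratr (code_dist t s) - ratr (code_dist t' s')| < 2 * d :> R.
  move=> [_ _ tt'] [_ _ ss']; rewrite -!pE -Ii ltr_norml.
  have := metric_triangle (I (p t)) (p t') (I (p s)).
  have := metric_triangle (p t') (p s') (I (p s)).
  have := metric_triangle (p t') (I (p t)) (p s').
  have := metric_triangle (I (p t)) (I (p s)) (p s').
  by rewrite (metric_sym (p t') (I _)) (metric_sym (p s') (I _)); lra.
have dist0 D i j : 0 <= dist D i j by exact: mdist_ge0.
have distC D i j : dist D i j = dist D j i by exact: metric_sym.
have d2 : 0 < 2 * d by lra.
have d50 : 2 * d <= 1 / 50 by lra.
have [s [sE sS] sle] := code_matching d2 d50 (dist0 A) (dist0 B) (distC B) Ml Mr Mact Mdis.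
(* The matching bounds distances in one direction only; the converse relation gives the other bound,
   with [s'] a left inverse of [s]. *)
have [||s' [s'E _] s'le] := code_matching (M := fun t t' => M t' t)
  d2 d50 (dist0 B) (dist0 A) (distC A) Mr Ml.
- by move=> t t' /Mact[].
- by move=> t t' v v' H1 H2; rewrite distrC; exact: Mdis.
have s'K i : s' (s i) = i by apply/esym/s'E/sE.
suff H : (GH A B <= (e / 2)%:E)%E by apply: le_lt_trans H _; rewrite lte_fin; lra.
have e2 : 0 < e / 2 by lra.
apply: (correspondence_GH (S := fun a b => exists i, a = alpha i A /\ b = alpha (s i) B)) => //.
- move=> a c Aa c0; have [i _ ia] := alphaD 0 Aa c0; exists (alpha i A), (alpha (s i) B).
  by split=> //; [exists i|rewrite metric_sym].
- move=> b c Bb c0; have [j _ jb] := alphaD 0 Bb c0; have [i ji] := sS j.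
  by exists (alpha i A), (alpha j B); split=> //; exists i; rewrite ji.
- move=> _ _ _ _ [i [-> ->]] [j [-> ->]]; rewrite -!/(dist _ _ _).
  have := sle i j; have := s'le (s i) (s j); rewrite !s'K ler_norml.
  lra.
Qed.

End GH_to_orbit.

Lemma GH_reducible_to_orbit {R : realType} {U : metricType R} (hU : urysohn_space U) :
  borel_uc_reducible (@GH R U) (@orbit_hausdorff R U).
Proof.
have [sepU cU extU] := hU.
(* An empty list of constraints yields a point of [U]. *)
have [u0 _] : exists y : U, forall x, x \in [::] -> mdist y x = 0.
  exact: (katetov_realized extU (s := [::]) (g := fun=> 0)).
have [u uD] := dense_sequence u0 sepU.
have [z [idx zF]] := katetov_frame_exists extU (inl 0%N : dist_code)
  code_dist_pseudometric u0 uD.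
have [alpha [aA aD aB]] := borel_dense_selection cU uD.
exists (code_set z idx alpha); first exact: borel_code_set.
move=> e e0; have [dX dX0 dXP] := orbit_of_GH cU zF aA aD e0.
have [dY dY0 dYP] := GH_of_orbit zF aA aD e0.
by exists dX, dY; split.
Qed.

(** * Stacking rescaled copies *)

Section multiscale.
Context {R : realType}.
Implicit Types (k l m : nat) (x y z : R).

Definition scale k : R := 2 ^+ k.
Definition cap k : R := scale k * scale k.
(** Truncation affects only distances above [scale k], hence no given distance once [k] is large,
    while an error [e] at level [k] means an error [e * halfpow k] in [U]. *)
Definition scaled k x : R := Num.min (cap k) (scale k * x).

Lemma scale_gt0 k : 0 < scale k. Proof. by rewrite exprn_gt0. Qed.

Lemma scale_lt k l : (k < l)%N -> 2 * scale k <= scale l.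
Proof. by move=> kl; rewrite /scale -exprS ler_eXn2l// ltr1n. Qed.

Lemma scale_le k l : (k <= l)%N -> scale k <= scale l.
Proof. by move=> kl; rewrite /scale ler_eXn2l// ltr1n. Qed.

Lemma scale_ge1 k : 1 <= scale k.
Proof. by rewrite /scale exprn_ege1// ler1n. Qed.

Lemma scaleV k : (scale k)^-1 = halfpow k. Proof. by rewrite /scale /halfpow exprVn. Qed.

Lemma cap_ge1 k : 1 <= cap k.
Proof. by rewrite /cap mulr_ege1// scale_ge1. Qed.

Lemma cap_lt k l : (k < l)%N -> 4 * cap k <= cap l.
Proof.
move=> kl; have := ler_pM _ _ (scale_lt kl) (scale_lt kl).
have := scale_gt0 k => s0 /(_ _ _)H; rewrite /cap.
have : 2 * scale k * (2 * scale k) <= scale l * scale l by apply: H; lra.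
lra.
Qed.

Lemma scaled0 k : scaled k 0 = 0.
Proof. by rewrite /scaled mulr0 min_r// (le_trans ler01)// cap_ge1. Qed.

Lemma scaled_le_cap k x : scaled k x <= cap k.
Proof. by rewrite /scaled ge_min lexx. Qed.

Lemma scaled_le k x : scaled k x <= scale k * x.
Proof. by rewrite /scaled ge_min lexx orbT. Qed.

Lemma scaledP k x : scaled k x = cap k \/ scaled k x = scale k * x.
Proof. by rewrite /scaled; case: leP; [left|right]. Qed.

Lemma scaled_ge0 k x : 0 <= x -> 0 <= scaled k x.
Proof.
move=> x0; have := cap_ge1 k; have := scale_gt0 k => s0.
by have [->|->] := scaledP k x; [lra|move=> _; rewrite mulr_ge0// ltW].
Qed.

Lemma scaled_eq0 k x : scaled k x = 0 -> x = 0.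
Proof.
have := cap_ge1 k; have := scale_gt0 k => s0.
have [->|->] := scaledP k x; first lra.
by move=> _ /eqP; rewrite mulf_eq0 gt_eqF//= => /eqP.
Qed.

Lemma scaled_mono k l x : (k <= l)%N -> 0 <= x -> scaled k x <= scaled l x.
Proof.
move=> kl x0; rewrite /scaled le_min; apply/andP; split.
  apply: le_trans (scaled_le_cap k x) _; rewrite /cap.
  by rewrite ler_pM ?scale_le// ltW// scale_gt0.
by apply: le_trans (scaled_le k x) _; rewrite ler_wpM2r// scale_le.
Qed.

Lemma scaled_triangle k x y z : 0 <= x -> 0 <= y -> z <= x + y ->
  scaled k z <= scaled k x + scaled k y.
Proof.
move=> x0 y0 zxy; have sx := scaled_ge0 k x0; have sy := scaled_ge0 k y0.
have zc := scaled_le_cap k z; have zs := scaled_le k z.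
have szxy : scale k * z <= scale k * x + scale k * y.
  by rewrite -mulrDr ler_wpM2l// ltW// scale_gt0.
have [ex|ex] := scaledP k x; first by lra.
by have [ey|ey] := scaledP k y; lra.
Qed.

Lemma scaled_lt k x (e : R) : e <= 1 -> scaled k x < e -> x < e * halfpow k.
Proof.
move=> e1; have := cap_ge1 k; have := scale_gt0 k => s0.
have [->|->] := scaledP k x; first lra.
by move=> _; rewrite -scaleV ltr_pdivlMr// mulrC.
Qed.

Lemma scaled_lipschitz0 x y : `|scaled 0 x - scaled 0 y| <= `|x - y|.
Proof.
rewrite /scaled /cap /scale !expr0 !mul1r; have := ler_norm (x - y).
have := ler_norm (y - x); rewrite (distrC y) ler_norml.
by case: (leP 1 x); case: (leP 1 y); lra.
Qed.

(** The margin 1 puts the image of [x] at least [scale k], so at least 1, below the cap; hence [y]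
    is not truncated either. *)
Lemma scaled_close k x y (e : R) : e <= 1 -> x + 1 <= scale k ->
  `|scaled k x - scaled k y| < e -> `|x - y| < e * halfpow k.
Proof.
move=> e1 xs; have s0 := scale_gt0 k.
have : scale k * (x + 1) <= cap k by rewrite /cap ler_wpM2l// ltW.
rewrite mulrDr mulr1 => xc; have s1 := scale_ge1 k.
have -> : scaled k x = scale k * x by rewrite /scaled min_r//; lra.
have [->|->] := scaledP k y; first by rewrite ltr_norml; lra.
rewrite -mulrBr normrM gtr0_norm// => H.
by rewrite -scaleV ltr_pdivlMr// mulrC.
Qed.

End multiscale.

(** Comparing a pair of level [k] with one of a later level bounds the drift of the images of a
    point by [e * halfpow k.+1]: they form a Cauchy sequence, whose limit preserves distances. The
    converse relations give the inverse. *)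
Lemma limit_isometry {R : realType} {U : metricType R} (cU : complete_space U)
    (S : nat -> U -> U -> Prop) (e : R) : 0 < e -> e <= 1 ->
  (forall k x, exists y, S k x y) -> (forall k y, exists x, S k x y) ->
  (forall k l x y x' y', (k <= l)%N -> S k x y -> S l x' y' ->
    `|scaled k.+1 (mdist x x') - scaled k.+1 (mdist y y')| < e) ->
  exists2 I, Iso U I & forall k x y, S k x y -> mdist (I x) y <= e * halfpow k.+1.
Proof.
move=> e0 e1.
have small c : 0 < c -> exists k, forall l, (k <= l)%N -> e * halfpow l.+1 < c.
  move=> /halfpow_small[k kc]; exists k => l kl; apply: le_lt_trans kc.
  have -> : l.+1 = (k + (l - k).+1)%N by lia.
  apply: le_trans (halfpow_le k (l - k).+1); rewrite ler_piMl//.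
  exact/ltW/halfpow_gt0.
have lim (T : nat -> U -> U -> Prop) : (forall k x, exists y, T k x y) ->
    (forall k l x y x' y', (k <= l)%N -> T k x y -> T l x' y' ->
      `|scaled k.+1 (mdist x x') - scaled k.+1 (mdist y y')| < e) ->
    exists2 I, isometric_embedding I &
      forall k x y, T k x y -> mdist (I x) y <= e * halfpow k.+1.
  move=> Tt Tdis.
  have Tnear k l x y y' : (k <= l)%N -> T k x y -> T l x y' ->
      mdist y y' < e * halfpow k.+1.
    move=> kl xy xy'; have := Tdis _ _ _ _ _ _ kl xy xy'.
    rewrite mdistxx scaled0 sub0r normrN ger0_norm ?scaled_ge0 ?mdist_ge0//.
    exact: scaled_lt.
  have /choice[I IP] x : exists v, forall k y, T k x y -> mdist v y <= e * halfpow k.+1.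
    have /choice[y yP] k := Tt k x.
    have [c c0|v vP] := cauchy_limit cU (y := y).
      have [k kc] := small (c / 2) ltac:(lra); exists k => m n km kn.
      have := Tnear _ _ _ _ _ km (yP k) (yP m); have := Tnear _ _ _ _ _ kn (yP k) (yP n).
      have := kc k (leqnn k); have := metric_triangle (y m) (y k) (y n).
      by rewrite (metric_sym (y m) (y k)); lra.
    exists v => k y' xy'; apply/ler_addgt0Pr => c c0; have [N NP] := vP c c0.
    have := NP (N + k)%N (leq_addr _ _).
    have := Tnear _ _ _ _ _ (leq_addl N k) xy' (yP (N + k)%N).
    have := metric_triangle v (y (N + k)%N) y'.
    by rewrite (metric_sym v (y _)) (metric_sym (y _) y'); lra.
  exists I => [x x'|k x y]; last exact: IP.
  apply: dist_eq_approx => c c0.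
  have [k kc] := small (c / 3) ltac:(lra).
  (* From level [j] on, the distance of [x] and [x'] lies below the truncation. *)
  have [j jx] : exists j, mdist x x' + 1 <= scale j.
    have D0 : 0 < (mdist x x' + 1)^-1 by rewrite invr_gt0; have := mdist_ge0 x x'; lra.
    have [j jP] := halfpow_small D0; exists j.
    rewrite -(invrK (scale j)) scaleV -[leLHS]invrK lef_pV2 ?posrE ?halfpow_gt0//.
    exact: ltW.
  set l := (j + k)%N; have [y xy] := Tt l x; have [y' xy'] := Tt l x'.
  have := kc l (leq_addl _ _); have := IP _ _ _ xy; have := IP _ _ _ xy'.
  have jl : mdist x x' + 1 <= scale l.+1.
    by apply: le_trans jx _; apply: scale_le; rewrite /l; lia.
  have := scaled_close e1 jl (Tdis _ _ _ _ _ _ (leqnn l) xy xy').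
  rewrite ltr_norml ler_norml.
  have := metric_triangle (I x) y (I x'); have := metric_triangle y y' (I x').
  have := metric_triangle y (I x) y'; have := metric_triangle (I x) (I x') y'.
  by rewrite (metric_sym y (I x)) (metric_sym y' (I x')); lra.
move=> Sl Sr Sdis; have [I Ii IP] := lim S Sl Sdis.
have [||J Ji JP] := lim (fun k x y => S k y x).
- exact: Sr.
- by move=> k l x y x' y' kl xy xy'; rewrite distrC; exact: Sdis xy xy'.
exists I => //; split=> //; apply/seteqP; split=> // y _; exists (J y) => //.
apply: mdist_positivity; apply: dist_eq_approx => c c0.
have [k kc] := small (c / 2) ltac:(lra); have [x xy] := Sr k y.
have := IP _ _ _ xy; have := JP _ _ _ xy; have := kc k (leqnn k).
have := metric_triangle (I (J y)) (I x) y; have := Ii (J y) x => ->.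
by rewrite subr0 ger0_norm ?mdist_ge0//; lra.
Qed.

Section marked_space.
Context {R : realType} {U : metricType R}.

(* [Some (x, k)] is the point [x] in the [k]-th copy of [U], where distances are
   multiplied by [2 ^ k] and capped; the copies lie at distinct distances from
   [None], so that an approximate isometry must preserve them. *)
Definition stack_dist (a b : option (U * nat)) : R :=
  match a, b with
  | None, None => 0
  | None, Some (_, k) | Some (_, k), None => 8 + 2 * cap k
  | Some (x, k), Some (y, l) =>
      `|2 * cap k - 2 * cap l| + scaled (minn k l) (mdist x y)
  end.

Lemma cap_gap k l : (k < l)%N -> cap l <= 2 * cap l - 2 * cap k :> R.
Proof. by move=> /(@cap_lt R); have := @cap_ge1 R k; lra. Qed.

Lemma stack_dist_metric : is_metric stack_dist.
Proof.
have c1 := @cap_ge1 R.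
have absC (k l : nat) : (k <= l)%N -> `|2 * cap k - 2 * cap l| = 2 * cap l - 2 * cap k :> R.
  rewrite leq_eqVlt => /predU1P[->|kl]; first by rewrite !subrr normr0.
  by have := cap_gap kl; have := c1 l; rewrite distrC => ? ?; rewrite ger0_norm//; lra.
split.
- by move=> [[x k]|] //=; rewrite mdistxx scaled0 subrr normr0 addr0.
- move=> [[x k]|] [[y l]|] //=; [|by move=> H; exfalso; have := c1 k; lra|by move=> H; exfalso; have := c1 l; lra].
  have s0 n := scaled_ge0 n (mdist_ge0 x y).
  have [kl|lk|->] := ltngtP k l => H.
  + exfalso; have := cap_gap kl; have := c1 l; have := s0 k; move: H.
    by rewrite (absC k l (ltnW kl)); lra.
  + exfalso; have := cap_gap lk; have := c1 k; have := s0 l; move: H.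
    by rewrite (distrC (2 * cap k)) (absC l k (ltnW lk)); lra.
  + by move: H; rewrite subrr normr0 add0r => /scaled_eq0/mdist_positivity ->.
- by move=> [[x k]|] [[y l]|] //=; rewrite distrC minnC metric_sym.
move=> [[y m]|] [[x k]|] [[z l]|] /=.
- have xyz := metric_triangle x y z.
  have xy0 := mdist_ge0 x y; have yz0 := mdist_ge0 y z.
  have [mn|nm] := leqP (minn k l) m.
    have := scaled_triangle (minn k l) xy0 yz0 xyz.
    have : scaled (minn k l) (mdist x y) <= scaled (minn k m) (mdist x y).
      by apply: scaled_mono => //; lia.
    have : scaled (minn k l) (mdist y z) <= scaled (minn m l) (mdist y z).
      by apply: scaled_mono => //; lia.
    by have := ler_distD (2 * cap m) (2 * cap k) (2 * cap l : R); lra.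
  (* The middle copy is coarser than both others. The detour to its level and back exceeds the gap
     of levels by [4 * (cap (minn k l) - cap m)], at least [3 * cap (minn k l)], which outweighs any
     truncated distance. *)
  have [mk ml] : (m < k)%N /\ (m < l)%N by lia.
  have := @cap_lt R _ _ mk; have := @cap_lt R _ _ ml.
  rewrite (distrC (2 * cap k) (2 * cap m)) !(absC m)//; [|lia|lia].
  have := scaled_ge0 (minn k m) xy0; have := scaled_ge0 (minn m l) yz0.
  have := scaled_le_cap (minn k l) (mdist x z).
  have [kl|lk] := leqP k l; first by rewrite absC//; have := c1 m; lra.
  by rewrite distrC absC 1?ltnW//; have := c1 m; lra.
- have := scaled_ge0 (minn k m) (mdist_ge0 x y); have := ler_norm (2 * cap k - 2 * cap m : R); lra.
- have := scaled_ge0 (minn m l) (mdist_ge0 y z); have := ler_norm (2 * cap l - 2 * cap m : R).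
  by rewrite distrC; lra.
- by have := c1 m; lra.
- have := scaled_le_cap (minn k l) (mdist x z); have := c1 k; have := c1 l.
  have [kl|lk] := leqP k l; first by rewrite absC//; lra.
  by rewrite distrC absC 1?ltnW//; lra.
- by rewrite addr0.
- by rewrite add0r.
- by rewrite addr0.
Qed.

Lemma stack_dist_rational x y k l : is_rational (mdist x y : R) ->
  is_rational (stack_dist (Some (x, k)) (Some (y, l))).
Proof.
have ratn (n : nat) : is_rational (n%:R : R) by exists n%:R; rewrite ratr_nat.
have ratM (a b : R) : is_rational a -> is_rational b -> is_rational (a * b).
  by move=> [p ->] [q ->]; exists (p * q); rewrite rmorphM.
have rats j : is_rational (scale j : R) by rewrite /scale -natrX.
have ratc j : is_rational (2 * cap j : R) by apply: (ratM) => //; exact: ratM.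
move=> xy; apply: is_rationalD.
  have [p ->] := ratc k; have [q ->] := ratc l.
  by exists `|p - q|; rewrite ratr_norm rmorphB.
by have [->|->] := scaledP (minn k l) (mdist x y); apply: ratM.
Qed.

End marked_space.

(** A countable dense part of the stack with rational distances is embedded by a frame; completeness
    of [U] extends the embedding to the whole stack. *)
Lemma stack_embedding {R : realType} {U : metricType R} (hU : urysohn_space U) (u0 : U)
    (u : nat -> U) : (forall v (e : R), 0 < e -> exists n, mdist (u n) v < e) ->
  exists p : option (U * nat) -> U,
    forall a b, mdist (p a) (p b) = stack_dist a b.
Proof.
move=> uD; have [_ cU extU] := hU.
have d0 : is_pseudometric (fun _ _ : unit => 0 : rat) by split.
(* The frame over a one-point space supplies a dense sequence of [U] with rational mutual
   distances. *)
have [z [idx0 zF]] := katetov_frame_exists extU tt d0 u0 uD.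
pose T : countType := option (nat * nat).
pose f : T -> option (U * nat) := omap (fun mk => (z mk.1, mk.2)).
have /choice[d dP] (st : T * T) : exists q : rat,
    stack_dist (f st.1) (f st.2) = ratr q :> R.
  have r8 k : is_rational (8 + 2 * cap k : R).
    apply: is_rationalD; first by exists 8; rewrite rmorph_nat.
    by exists (2 * (2 ^+ k * 2 ^+ k)); rewrite !rmorphM /= rmorphXn /= !ratr_nat.
  case: st => [[[m k]|] [[n l]|]] //=.
  - by apply: stack_dist_rational; exact: frame_rational zF m n.
  - exact: r8.
  - exact: r8.
  - exact: is_rational0.
have E s t : stack_dist (f s) (f t) = ratr (d (s, t)) :> R := dP (s, t).
have [sxx seq ssym stri] := @stack_dist_metric R U.
have dpm : is_pseudometric (fun s t => d (s, t)).
  split=> [s|s t|t s v].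
  - by apply: (fmorph_inj (@ratr R)); rewrite /= -E sxx rmorph0.
  - by apply: (fmorph_inj (@ratr R)); rewrite /= -!E ssym.
  - by rewrite -(ler_rat R) rmorphD /= -!E stri.
have [z' [idx zF']] := katetov_frame_exists extU (None : T) dpm u0 uD.
pose Y : metricType R := metric_of (@stack_dist_metric R U).
have [|s t|p pi _] := @isometry_extension _ _ cU Y T f (fun t => z' (idx t)).
- move=> [[x k]|] e e0; last by exists None; rewrite mdistxx.
  have [|n nx] := frame_dense zF x (_ : 0 < e / scale k).
    by rewrite divr_gt0// scale_gt0.
  exists (Some (n, k)).
  suff : stack_dist (Some (z n, k)) (Some (x, k)) < e by [].
  rewrite /= subrr normr0 add0r; apply: le_lt_trans (scaled_le _ _) _.
  by rewrite minnn mulrC -ltr_pdivlMr// scale_gt0.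
- by rewrite (frame_isometric zF') -E.
exists p => a b; exact: pi.
Qed.

(** * Reduction of the orbit pseudometric *)

Section orbit_to_GH.
Context {R : realType} {U : metricType R}.
Hypothesis hU : urysohn_space U.
Variables (u : nat -> U) (p : option (U * nat) -> U).
Hypothesis uD : forall v (e : R), 0 < e -> exists n, mdist (u n) v < e.
Hypothesis pE : forall a b, mdist (p a) (p b) = stack_dist a b.

Definition marked (A : nonempty_closed U) (a : option (U * nat)) : Prop :=
  if a is Some (x, 0) then closed_val A x else True.

Let S A := [set p a | a in marked A].
Let S0 A : S A !=set0. Proof. by exists (p None); exists None. Qed.

Definition marked_set A := closure_of (S0 A).

Let marked_set_in A a : marked A a -> closed_val (marked_set A) (p a).
Proof. by move=> Aa; apply: subset_closure; exists a. Qed.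

Let marked_set_near A v (e : R) : closed_val (marked_set A) v -> 0 < e ->
  exists2 a, marked A a & mdist v (p a) < e.
Proof. by move=> /closure_dist H /H[_ [a Aa <-]]; exists a. Qed.

Let level_dist (x y : U) k : stack_dist (Some (x, k)) (Some (y, k)) = scaled k (mdist x y).
Proof. by rewrite /= subrr normr0 add0r minnn. Qed.

Let level0_le (x y : U) : stack_dist (Some (x, 0%N)) (Some (y, 0%N)) <= mdist x y.
Proof. by rewrite level_dist; have := scaled_le 0 (mdist x y); rewrite /scale expr0 mul1r. Qed.

(** Points outside level 0 contribute a condition independent of [A]. At level 0, that [A] meets an
    open set is witnessed by a ball around some [u m] inside it. *)
Lemma borel_marked_set : borel_map marked_set.
Proof.
apply: (borel_mapP uD) => n q.
pose fixed (a : option (U * nat)) := if a is Some (_, 0%N) then False else True.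
have : borel (fun A => (exists a, fixed a /\ mdist (u n) (p a) < q) \/
    exists mk : nat * nat, dist_to (u mk.1) A < mk.2.+1%:R^-1 /\
      forall x, mdist (u mk.1) x < mk.2.+1%:R^-1 ->
        mdist (u n) (p (Some (x, 0%N))) < q).
  apply: borel_or (borel_const _) _; apply: borel_ex => mk.
  by apply: borel_and (borel_const _); exact: borel_dist_to_lt.
apply: borel_ext => A; split.
  move=> [[a [fa na]]|[[m k] /= [/dist_to_lt[x Ax mx] H]]]; apply/dist_to_closure.
    by exists (p a) => //; exists a => //; case: (a) fa => [[x []]|].
  by exists (p (Some (x, 0%N))); [exists (Some (x, 0%N))|exact: H].
move=> /dist_to_closure[_ [a Aa <-] na].
case: a Aa na => [[x [|k]]|] /= Ax na; first last.
- by left; exists None.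
- by left; exists (Some (x, k.+1)).
right; have d0 : 0 < (q - mdist (u n) (p (Some (x, 0%N)))) / 2.
  by rewrite divr_gt0// subr_gt0.
have [k kP] := small_inv d0.
have [|m mx] := uD x (_ : 0 < k.+1%:R^-1); first by rewrite invr_gt0 ltr0n.
exists (m, k); split=> [|y my]; first by apply/dist_to_lt; exists x.
have kmx := lt_trans mx kP; have kmy := lt_trans my kP.
have := metric_triangle (u n) (p (Some (x, 0%N))) (p (Some (y, 0%N))).
have := level0_le x y; rewrite -pE; have := metric_triangle x (u m) y.
by rewrite (metric_sym x (u m)); move: kmx kmy; lra.
Qed.

(** The isometry [I] acts exactly on the levels above 0 and up to [d] on level 0, where truncated
    distances are 1-Lipschitz in the original ones; the distortion is at most [2 * d]. *)
Lemma GH_of_orbit_marked (e : R) : 0 < e -> exists2 d : R, 0 < d &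
  forall A B, (orbit_hausdorff A B < d%:E)%E ->
    (GH (marked_set A) (marked_set B) < e%:E)%E.
Proof.
move=> e0; pose d := e / 4; have d0 : 0 < d by rewrite /d; lra.
exists d => // A B /orbit_hausdorff_lt[I [Ii IS] [AB BA]].
suff H : (GH (marked_set A) (marked_set B) <= (e / 2)%:E)%E.
  by apply: le_lt_trans H _; rewrite lte_fin; lra.
pose C (a b : option (U * nat)) : Prop := match a, b with
  | None, None => True
  | Some (x, 0%N), Some (y, 0%N) =>
      [/\ closed_val A x, closed_val B y & mdist (I x) y < d]
  | Some (x, k.+1), Some (y, l.+1) => k = l /\ y = I x
  | _, _ => False end.
have Cl a : marked A a -> exists2 b, marked B b & C a b.
  case: a => [[x [|k]]|] /= Ax; last by exists None.
    by have [y By xy] := AB x Ax; exists (Some (y, 0%N)).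
  by exists (Some (I x, k.+1)).
have Cr b : marked B b -> exists2 a, marked A a & C a b.
  case: b => [[y [|k]]|] /= By; last by exists None.
    by have [x Ax xy] := BA y By; exists (Some (x, 0%N)).
  have [x _ xy] : range I y by rewrite IS.
  by exists (Some (x, k.+1)).
have Cdis x y x' y' k l : C (Some (x, k)) (Some (y, k)) ->
    C (Some (x', l)) (Some (y', l)) ->
    `|scaled (minn k l) (mdist x x') - scaled (minn k l) (mdist y y')| <= 2 * d.
  have near (a b : U) j : C (Some (a, j)) (Some (b, j)) ->
      mdist (I a) b < d /\ ((0 < j)%N -> b = I a).
    by case: j => [[_ _ ab]|j [_ ->]]; split; rewrite ?mdistxx.
  move=> /near[xy xyI] /near[xy' xyI'].
  have [kl|] := ltnP 0 (minn k l).
    rewrite xyI ?xyI' ?Ii ?subrr ?normr0//; [lra|lia|lia].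
  rewrite leqn0 => /eqP ->; apply: le_trans (scaled_lipschitz0 _ _) _.
  rewrite -(Ii x x') ler_norml.
  have := metric_triangle (I x) y (I x'); have := metric_triangle y y' (I x').
  have := metric_triangle y (I x) y'; have := metric_triangle (I x) (I x') y'.
  by rewrite (metric_sym y (I x)) (metric_sym y' (I x')); lra.
apply: (correspondence_GH (S := fun v w => exists a b, [/\ v = p a, w = p b & C a b])).
- by lra.
- move=> v c Av c0; have [a Aa va] := marked_set_near Av c0.
  have [b Bb ab] := Cl _ Aa; exists (p a), (p b).
  by split=> //; [exact: marked_set_in|exists a, b].
- move=> w c Bw c0; have [b Bb wb] := marked_set_near Bw c0.
  have [a Aa ab] := Cr _ Bb; exists (p a), (p b); split=> //.
  + exact: marked_set_in.
  + by exists a, b.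
  + by rewrite metric_sym.
- have Clev x k b : C (Some (x, k)) b -> exists y, b = Some (y, k).
    case: k b => [|k] [[y [|l]]|] //=; first by exists y.
    by move=> [-> _]; exists y.
  have CN b : C None b -> b = None by case: b => [[]|].
  move=> _ _ _ _ [a [b [-> -> ab]]] [a' [b' [-> -> ab']]]; rewrite !pE.
  case: a ab => [[x k] ab|/CN ->]; case: a' ab' => [[x' l] ab'|/CN ->].
  + have [y yE] := Clev _ _ _ ab; have [y' yE'] := Clev _ _ _ ab'; subst b b'.
    have := Cdis _ _ _ _ _ _ ab ab'; rewrite /= /d !ler_norml; lra.
  + by have [y ->] := Clev _ _ _ ab; rewrite /= subrr normr0; lra.
  + by have [y ->] := Clev _ _ _ ab'; rewrite /= subrr normr0; lra.
  + by rewrite /= subrr normr0; lra.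
Qed.

(** A relation of small distortion fixes [None], hence the distances to [None], hence the levels.
    The full levels yield an isometry in the limit, and level 1 ties it to the two sets at level
    0. *)
Lemma orbit_of_GH_marked (e : R) : 0 < e -> exists2 d : R, 0 < d &
  forall A B, (GH (marked_set A) (marked_set B) < d%:E)%E ->
    (orbit_hausdorff A B < e%:E)%E.
Proof.
move=> e0; pose d := Num.min (e / 24) (1 / 24).
have d0 : 0 < d by rewrite lt_min; lra.
have de : d <= e / 24 by rewrite /d ge_min lexx.
have d1 : d <= 1 / 24 by rewrite /d ge_min lexx orbT.
exists d => // A B /GH_correspondence[C [CA CB Cdis]].
pose M a b := [/\ marked A a, marked B b & exists v w,
  [/\ C v w, mdist (p a) v < d & mdist (p b) w < d]].
have Ml a : marked A a -> exists b, M a b.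
  move=> Aa; have [w Bw vw] := CA _ (marked_set_in Aa).
  have [b Bb wb] := marked_set_near Bw d0; exists b; split=> //.
  by exists (p a), w; rewrite mdistxx (metric_sym _ w).
have Mr b : marked B b -> exists a, M a b.
  move=> Bb; have [v Av vw] := CB _ (marked_set_in Bb).
  have [a Aa va] := marked_set_near Av d0; exists a; split=> //.
  by exists v, (p b); rewrite mdistxx (metric_sym _ v).
pose h := 6 * d.
have Mdis a b a' b' : M a b -> M a' b' -> `|stack_dist a a' - stack_dist b b'| < h.
  move=> [_ _ [v [w [vw av bw]]]] [_ _ [v' [w' [vw' av' bw']]]].
  have := Cdis _ _ _ _ vw vw'; rewrite -!pE !ltr_norml /h.
  have := metric_triangle (p a) v (p a'); have := metric_triangle v v' (p a').
  have := metric_triangle v (p a) v'; have := metric_triangle (p a) (p a') v'.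
  have := metric_triangle (p b) w (p b'); have := metric_triangle w w' (p b').
  have := metric_triangle w (p b) w'; have := metric_triangle (p b) (p b') w'.
  rewrite (metric_sym v (p a)) (metric_sym v' (p a')).
  by rewrite (metric_sym w (p b)) (metric_sym w' (p b')); lra.
have h1 : h <= 1 / 4 by rewrite /h; lra.
have h0 : 0 < h by rewrite /h; lra.
(* [None] has no other point within distance 7, the others have one. *)
have companion D b : marked D b -> b <> None ->
    exists2 b', marked D b' & 1 <= stack_dist b b' <= 6.
  case: b => [[y k]|//] Db _; case: k Db => [|k] Db.
    (* The same point one level up is at distance 6, as [cap 0] is 1 and [cap 1] is 4; on a full
       level, a point at distance [halfpow k.+1] rescales to distance exactly 1. *)
    exists (Some (y, 1%N)) => //.
    rewrite /= mdistxx scaled0 /cap /scale expr0 expr1 addr0.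
    by rewrite (_ : _ - _ = - 6); [rewrite normrN ger0_norm; lra|lra].
  have k1 : 0 < halfpow k.+1 :> R by exact: halfpow_gt0.
  have [_ _ extU] := hU.
  have [|y' y'P] := katetov_realized extU (s := [:: y]) (g := fun=> halfpow k.+1).
    by move=> a b; rewrite !inE => /eqP -> /eqP ->; rewrite mdistxx; lra.
  exists (Some (y', k.+1)) => //; rewrite level_dist metric_sym y'P ?mem_head//.
  rewrite -scaleV /scaled mulfV ?gt_eqF ?scale_gt0// min_r ?cap_ge1//; lra.
have far D b : marked D b -> stack_dist None b = 0 \/ 10 <= stack_dist None b.
  case: b => [[x k] _|]; last by left.
  by right; rewrite /=; have := @cap_ge1 R k; lra.
have MNl b : M None b -> b = None.
  move=> M1; apply: contrapT => bN; have [_ Bb _] := M1.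
  have [b' Bb' bb'] := companion B b Bb bN; have [a' M2] := Mr _ Bb'.
  have := Mdis _ _ _ _ M1 M2; have [Aa' _ _] := M2.
  by rewrite ltr_norml; case: (far _ _ Aa'); lra.
have MNr a : M a None -> a = None.
  move=> M1; apply: contrapT => aN; have [Aa _ _] := M1.
  have [a' Aa' aa'] := companion A a Aa aN; have [b' M2] := Ml _ Aa'.
  have := Mdis _ _ _ _ M1 M2; have [_ Bb' _] := M2.
  by rewrite ltr_norml; case: (far _ _ Bb'); lra.
have MN : M None None by have [b M1] := Ml None I; rewrite -{2}(MNl _ M1).
(* Distances from [None] to different levels differ by more than [h]. *)
have Mlev x k b : M (Some (x, k)) b -> exists y, b = Some (y, k).
  case: b => [[y l]|/MNr//] M1; exists y; congr (Some (_, _)).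
  have := Mdis _ _ _ _ MN M1; rewrite /= ltr_norml => kl.
  have [lk|lk|//] := ltngtP l k.
  - by exfalso; have := @cap_gap R _ _ lk; have := @cap_ge1 R k; lra.
  - by exfalso; have := @cap_gap R _ _ lk; have := @cap_ge1 R l; lra.
have Mlevr y k a : M a (Some (y, k)) -> exists x, a = Some (x, k).
  case: a => [[x l]|/MNl//] M1; exists x.
  by have [_ [_ ->]] := Mlev _ _ _ M1.
have [_ cU _] := hU.
have [||||I II IP] := limit_isometry cU h0
  (S := fun k x y => M (Some (x, k.+1)) (Some (y, k.+1))).
- by lra.
- move=> k x; have [//|b M1] := Ml (Some (x, k.+1)).
  by have [y yE] := Mlev _ _ _ M1; exists y; rewrite -yE.
- move=> k y; have [//|a M1] := Mr (Some (y, k.+1)).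
  by have [x xE] := Mlevr _ _ _ M1; exists x; rewrite -xE.
- move=> k l x y x' y' kl M1 M2; have := Mdis _ _ _ _ M1 M2.
  have kE : minn k.+1 l.+1 = k.+1 by lia.
  by rewrite /stack_dist kE !ltr_norml; lra.
(* The copies of [x] at levels 0 and 1 differ only by the gap of levels, so [y] is within [h] of the
   level 1 partner [y'], itself within [h / 2] of [I x]; the total is [9 * d], below [e / 2]. *)
have close x y : M (Some (x, 0%N)) (Some (y, 0%N)) -> mdist (I x) y < e / 2.
  move=> M1; have [//|b M2] := Ml (Some (x, 1%N)).
  have [y' y'E] := Mlev _ _ _ M2; subst b; have := IP _ _ _ M2.
  have := Mdis _ _ _ _ M1 M2; rewrite /= mdistxx scaled0 min0n ltr_norml => dis.
  have : scaled 0 (mdist y y') < h by lra.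
  move=> /scaled_lt => /(_ ltac:(lra)).
  rewrite /halfpow expr0 expr1 mulr1.
  have := metric_triangle (I x) y' y; rewrite (metric_sym y' y) /h; lra.
suff H : (orbit_hausdorff A B <= (e / 2)%:E)%E.
  by apply: le_lt_trans H _; rewrite lte_fin; lra.
apply: (orbit_hausdorff_le II) => [a Aa|b Bb].
  have [//|b M1] := Ml (Some (a, 0%N)); have [y yE] := Mlev _ _ _ M1; subst b.
  have [_ By _] := M1; exists y => //; exact/ltW/close.
have [//|a M1] := Mr (Some (b, 0%N)); have [x xE] := Mlevr _ _ _ M1; subst a.
have [Ax _ _] := M1; exists x => //; exact/ltW/close.
Qed.

End orbit_to_GH.

Lemma orbit_reducible_to_GH {R : realType} {U : metricType R} (hU : urysohn_space U) :
  borel_uc_reducible (@orbit_hausdorff R U) (@GH R U).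
Proof.
have [sepU cU extU] := hU.
have [u0 _] : exists y : U, forall x, x \in [::] -> mdist y x = 0.
  exact: (katetov_realized extU (s := [::]) (g := fun=> 0)).
have [u uD] := dense_sequence u0 sepU.
have [p pE] := stack_embedding hU u0 uD.
exists (marked_set p); first exact: borel_marked_set uD pE.
move=> e e0; have [dX dX0 dXP] := GH_of_orbit_marked pE e0.
have [dY dY0 dYP] := orbit_of_GH_marked hU pE e0.
by exists dX, dY; split.
Qed.

Theorem theorem1p3 (R : realType) (U : metricType R) (hU : urysohn_space U) :
  borel_uc_bireducible (@GH R U) (@orbit_hausdorff R U).
Proof. by split; [exact: GH_reducible_to_orbit|exact: orbit_reducible_to_GH]. Qed.
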